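(* Let $r\ge1$, let $N\subset A$ be a non-zero proper ideal satisfying the level assumption, let $R$ be a commutative $F$-algebra, and let $\rho\colon V^r_N\setminus\{0\}\to R$ be an $A$-reciprocal map such that for every $v\in V^r_N\setminus\{0\}$ we have $\rho(v)=0$ or $\rho(v)\in R^\times$. Let $\varphi\colon A\to R[\tau]$ be the $\mathbb{F}_q$-algebra homomorphism associated to $\rho$, let $W=\{0\}\cup\{v\in V^r_N\setminus\{0\}\mid\rho(v)\in R^\times\}$, which is an $A$-submodule of $V^r_N$, and let $\lambda\colon W\to R$ be the map with $\lambda(0)=0$ and $\lambda(v)=\rho(v)^{-1}$ for $v\neq0$. (a) If $W$ is zero, we have $\varphi_a=a$ in $R[\tau]$ for all $a\in A$. (b) If $W$ is non-zero, it is a free $A/N$-module of some rank $1\le s\le r$, and $\varphi$ is a standard Drinfeld $A$-module of rank $s$, and for any isomorphism of $A$-modules $i\colon V^s_N\to W$ the map $\lambda\circ i$ is a level $N$-structure of $\varphi$.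
   Context: $\mathbb{F}_q$ is a finite field with $q$ elements. $A$ is an admissible coefficient ring containing $\mathbb{F}_q$, i.e. the ring of elements of a global function field $F\supset\mathbb{F}_q$ that are regular outside one fixed place $\infty$; so $F=\mathrm{Quot}(A)$. For $a\in A\setminus\{0\}$ put $\deg_A(a)=\dim_{\mathbb{F}_q}(A/(a))$, and $\deg_A(0)=-\infty$. For a non-zero ideal $N\subset A$ put $\mathrm{Div}(N)=\{a\in A\mid N\subset (a)\}$. The image of $a\in A$ in an $F$-algebra is again denoted $a$. Level assumption on a non-zero proper ideal $N\subset A$: there exists a subset $D\subset\mathrm{Div}(N)$ such that (i) for any $a\in A\setminus\{0\}$ there is $b\in A\setminus\{0\}$ which is a product of elements of $D$ with $\deg_A(a-b)<\deg_A(a)$; (ii) for any distinct $a,b\in D$ we have $ab\in\mathrm{Div}(N)$; (iii) any element of $\mathrm{Div}(N)$ is a product of elements of $D$; (iv) $N$ is principal. $V^r_N=(N^{-1}/A)^{\oplus r}$ and $V^r_a=(a^{-1}A/A)^{\oplus r}$ for $a\in A\setminus\{0\}$; for $a\in\mathrm{Div}(N)$ we have $V^r_a\subset V^r_N$. A map $\rho\colon V^r_N\setminus\{0\}\to R$ is $A$-reciprocal if (1) $\rho(v)\rho(w)=\rho(v+w)(\rho(v)+\rho(w))$ for all $v,w\in V^r_N\setminus\{0\}$ with $v+w\ne0$, and (2) $a\rho(av)=\sum_{v'\in V^r_a}\rho(v-v')$ for all $a\in\mathrm{Div}(N)$ and $v\in V^r_N\setminus V^r_a$. $R[\tau]$ is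 the ring (under composition) of $\mathbb{F}_q$-linear polynomials $\sum_i u_iX^{q^i}=\sum_iu_i\tau^i$ over $R$; $u\in R$ is identified with $uX$. The homomorphism associated to an $A$-reciprocal map $\rho$ is the unique $\mathbb{F}_q$-algebra homomorphism $\varphi\colon A\to R[\tau]$, $a\mapsto\varphi_a$, such that $\varphi_a(X)=a\cdot X\cdot\prod_{v\in V^r_a\setminus\{0\}}(1-\rho(v)X)$ for all $a\in\mathrm{Div}(N)$ (it exists and is unique). A standard Drinfeld $A$-module of rank $s\ge1$ over $R$ is an $\mathbb{F}_q$-algebra homomorphism $\varphi\colon A\to R[\tau]$ such that for every $a\in A\setminus\{0\}$ we have $\varphi_a=\sum_{i=0}^{s\deg_A(a)}\varphi_{a,i}\tau^i$ with $\varphi_{a,s\deg_A(a)}\in R^\times$ and $\varphi_{a,0}=a$. Put $\varphi[N]=\bigcap_{a\in N}\mathrm{Ker}(\varphi_a)\subset\mathbb{G}_{a,R}$. A level $N$-structure of $\varphi$ is an $A$-module homomorphism $V^s_N\to\varphi[N](R)\subset R$ ($A$ acting on $R$ through $\varphi$) which induces an isomorphism in every (geometric) fiber over $\mathrm{Spec}(R)$. *)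

(* Defs.v *)
From HB Require Import structures.
From mathcomp Require Import all_boot all_order all_algebra.
From mathcomp Require Import mathcomp_extra boolp classical_sets functions.
From mathcomp Require Import cardinality fsbigop.

Set Implicit Arguments.
Unset Strict Implicit.
Unset Printing Implicit Defensive.

Import GRing.Theory.
Local Open Scope classical_set_scope.
Local Open Scope ring_scope.

Section CoefficientRing.
Variable F : fieldType.

(* A place is represented by its valuation ring.  When [F] is a function field
   over a finite field, such a ring is automatically discrete and contains the
   constants (which are roots of unity), so these are exactly the places. *)
Definition place (O : set F) : Prop :=
  [/\ subring_closed (mem O),
      O <> setT
    & forall z : F, O z \/ O z^-1].

Definition regular_outside (Oinf : set F) : {pred F} :=
  fun x => `[< forall O : set F, place O -> O <> Oinf -> O x >].

Lemma regular_subring_closed Oinf : subring_closed (regular_outside Oinf).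
Proof.
split=> [|x y /asboolP xO /asboolP yO|x y /asboolP xO /asboolP yO].
- by apply/asboolP => O [[+ _ _] _ _] _; rewrite inE.
- apply/asboolP => O pO Oi; have [[_ + _] _ _] := pO.
  by move/(_ x y); rewrite !inE; apply; [exact: xO|exact: yO].
apply/asboolP => O pO Oi; have [[_ _ +] _ _] := pO.
by move/(_ x y); rewrite !inE; apply; [exact: xO|exact: yO].
Qed.

HB.instance Definition _ (Oinf : set F) :=
  GRing.isSubringClosed.Build F (regular_outside Oinf)
    (regular_subring_closed Oinf).

Record coef_ring (Oinf : set F) := CoefRing {
  coef_val : F;
  coef_valP : coef_val \in regular_outside Oinf
}.

HB.instance Definition _ (Oinf : set F) :=
  [isSub for @coef_val Oinf].
HB.instance Definition _ (Oinf : set F) :=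
  [Choice of coef_ring Oinf by <:].
HB.instance Definition _ (Oinf : set F) :=
  [SubChoice_isSubComNzRing of coef_ring Oinf by <:].

(* The quotient F/A, made into an A-module below. *)
Definition FmodA (Oinf : set F) : Type :=
  Quotient.quot (regular_outside Oinf : zmodClosed F).

HB.instance Definition _ (Oinf : set F) := GRing.Zmodule.on (FmodA Oinf).

Definition classA (Oinf : set F) (x : F) : FmodA Oinf :=
  \pi_(Quotient.quot (regular_outside Oinf : zmodClosed F))%qT x.

Variable Oinf : set F.
Notation A := (coef_ring Oinf).

Lemma classA_eq (x y : F) :
  (classA Oinf x == classA Oinf y) = (x - y \in regular_outside Oinf).
Proof. by rewrite Quotient.idealrBE. Qed.

Lemma classAD (x y : F) :
  classA Oinf (x + y) = classA Oinf x + classA Oinf y.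
Proof. exact: raddfD. Qed.

Lemma classA_surj (u : FmodA Oinf) : exists x : F, u = classA Oinf x.
Proof. by exists (repr u); rewrite /classA reprK. Qed.

Definition scaleA (a : A) (u : FmodA Oinf) : FmodA Oinf :=
  classA Oinf (val a * repr u).

Lemma scaleA_class a x : scaleA a (classA Oinf x) = classA Oinf (val a * x).
Proof.
apply/eqP; rewrite classA_eq -mulrBr rpredM //; first exact: valP.
by rewrite -classA_eq /classA reprK.
Qed.

Lemma scaleA_assoc a b u : scaleA a (scaleA b u) = scaleA (a * b) u.
Proof. by have [x ->] := classA_surj u; rewrite !scaleA_class mulrA. Qed.

Lemma scaleA_1 : left_id 1 scaleA.
Proof. by move=> u; have [x ->] := classA_surj u; rewrite scaleA_class mul1r. Qed.

Lemma scaleA_Dr : right_distributive scaleA +%R.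
Proof.
move=> a u v; have [x ->] := classA_surj u; have [y ->] := classA_surj v.
by rewrite -classAD !scaleA_class mulrDr classAD.
Qed.

Lemma scaleA_Dl u : {morph scaleA^~ u : a b / a + b}.
Proof.
move=> a b; have [x ->] := classA_surj u.
by rewrite !scaleA_class mulrDl classAD.
Qed.

HB.instance Definition _ := GRing.Zmodule_isLmodule.Build A (FmodA Oinf)
  scaleA_assoc scaleA_1 scaleA_Dr scaleA_Dl.

End CoefficientRing.

(* E is a finite extension of a rational function field K(t). *)
Definition global_function_field (K : finFieldType) (E : fieldType)
    (j : {rmorphism K -> E}) : Prop :=
  exists2 t : E, ~ algebraicOver j t
  & exists (n : nat) (e : 'I_n -> E), forall x : E,
    exists f g : 'I_n -> {poly K},
      x = \sum_(i < n) (map_poly j (f i)).[t] / (map_poly j (g i)).[t] * e i.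

Section Coefficients.
Variables (K : finFieldType) (F : fieldType) (Oinf : set F).
Notation A := (coef_ring Oinf).
Notation FA := (FmodA Oinf).
Variable iota : {rmorphism K -> A}.

Definition Div (N : {pred A}) : set A :=
  [set a | forall n, n \in N -> exists b, n = a * b].

(* deg_A(a) = d, i.e. a is non-zero and A/(a) has a K-basis e_1, ..., e_d. *)
Definition degA_is (a : A) (d : nat) : Prop :=
  a != 0 /\ exists e : 'I_d -> A, forall x : A,
    exists! c : {ffun 'I_d -> K},
      exists y : A, x - \sum_(i < d) iota (c i) * e i = a * y.

(* deg_A(a) < deg_A(b) for b non-zero, with deg_A(0) = -oo. *)
Definition degA_lt (a b : A) : Prop :=
  exists2 d, degA_is b d & a = 0 \/ exists2 d', degA_is a d' & (d' < d)%N.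

(* Empty products are allowed. *)
Definition product_of (D : set A) (b : A) : Prop :=
  exists2 s : seq A, (forall x, x \in s -> D x) & b = \prod_(x <- s) x.

Definition principal (N : {pred A}) : Prop :=
  exists2 n, n \in N & forall x, x \in N -> exists b, x = n * b.

Definition level_assumption (N : {pred A}) : Prop :=
  exists2 D : set A, D `<=` Div N &
  [/\ forall a, a != 0 ->
        exists b, [/\ b != 0, product_of D b & degA_lt (a - b) a],
      forall a b, D a -> D b -> a <> b -> Div N (a * b),
      forall a, Div N a -> product_of D a
    & principal N].

(* N^-1 = {x in F | x N is contained in A} *)
Definition inv_ideal (N : {pred A}) : set F :=
  [set x | forall n : A, n \in N -> x * val n \in regular_outside Oinf].

(* V^r_N = (N^-1/A)^r and V^r_a = (a^-1 A/A)^r, both inside (F/A)^r *)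
Definition VN (r : nat) (N : {pred A}) : set {ffun 'I_r -> FA} :=
  [set v | forall i, exists2 x, inv_ideal N x & v i = classA Oinf x].

Definition Va (r : nat) (a : A) : set {ffun 'I_r -> FA} :=
  [set v | forall i, exists b : A, v i = classA Oinf ((val a)^-1 * val b)].

(* Freeness over A/N of an A-module W killed by N: a family e_1, ..., e_s of
   elements of W which generates W, and whose only relations are those with
   coefficients in N. *)
Definition free_of_rank (V : lmodType A) (N : {pred A}) (W : set V) (s : nat) :=
  exists e : 'I_s -> V,
    [/\ forall i, W (e i),
        forall w, W w -> exists c : 'I_s -> A, w = \sum_(i < s) c i *: e i
      & forall c : 'I_s -> A,
          \sum_(i < s) c i *: e i = 0 <-> forall i, c i \in N].

Section Algebra.
Variable R : comUnitAlgType F.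

(* [rho] stands for a map on V^r_N \ {0}: its other values are irrelevant. *)
Definition reciprocal (r : nat) (N : {pred A}) (rho : {ffun 'I_r -> FA} -> R) :=
  (forall v w, VN N v -> VN N w -> v != 0 -> w != 0 -> v + w != 0 ->
     rho v * rho w = rho (v + w) * (rho v + rho w)) /\
  (forall a v, Div N a -> VN N v -> ~ Va a v ->
     (val a)%:A * rho (a *: v) = \sum_(v' \in Va a) rho (v - v')).

(* The elements of R[tau], as polynomials in X with tau^i = X^(q^i). *)
Definition tau_poly (p : {poly R}) : Prop :=
  forall n, p`_n != 0 -> exists i : nat, n = (#|K| ^ i)%N.

(* K-algebra homomorphisms A -> R[tau]; the product of R[tau] is \Po. *)
Definition tau_hom (phi : A -> {poly R}) : Prop :=
  [/\ forall a, tau_poly (phi a),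
      forall a b, phi (a + b) = phi a + phi b,
      forall a b, phi (a * b) = phi a \Po phi b
    & forall c : K, phi (iota c) = (val (iota c))%:A *: 'X].

Definition associated (r : nat) (N : {pred A}) (rho : {ffun 'I_r -> FA} -> R)
    (phi : A -> {poly R}) : Prop :=
  tau_hom phi /\
  forall a, Div N a ->
    phi a = (val a)%:A *: ('X *
      \big[*%R/1]_(v \in Va a `\ (0 : {ffun 'I_r -> FA})) (1 - rho v *: 'X)).

(* The coefficient phi_{a,i} of tau^i in phi_a is (phi a)`_(q^i). *)
Definition standard_drinfeld (s : nat) (phi : A -> {poly R}) : Prop :=
  tau_hom phi /\
  forall a, a != 0 -> exists d, [/\ degA_is a d,
      phi a = \sum_(i < (s * d).+1) (phi a)`_(#|K| ^ i) *: 'X^(#|K| ^ i),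
      (phi a)`_(#|K| ^ (s * d)) \is a GRing.unit
    & (phi a)`_1 = (val a)%:A].

(* The ideal of L[X] generated by the images of the phi_a with a in N, so that
   the fiber of phi[N] at g is Spec L[X]/(torsion_ideal). *)
Definition torsion_ideal (N : {pred A}) (phi : A -> {poly R}) (L : fieldType)
    (g : {rmorphism R -> L}) : set {poly L} :=
  [set p | exists2 t : seq ({poly L} * A), (forall x, x \in t -> x.2 \in N)
         & p = \sum_(x <- t) x.1 * map_poly g (phi x.2)].

(* [lam] stands for a map V^s_N -> R.  At a point g : R -> L, where L is any
   field (in particular a residue field, or an algebraically closed field),
   the induced morphism from the constant scheme V^s_N to the fiber of phi[N]
   corresponds to the ring homomorphism
   L[X]/(torsion_ideal) -> L^(V^s_N), p |-> (p (g (lam v)))_v;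
   the last condition says that the latter is surjective and injective. *)
Definition level_structure (s : nat) (N : {pred A}) (phi : A -> {poly R})
    (lam : {ffun 'I_s -> FA} -> R) : Prop :=
  [/\ forall v a, VN N v -> a \in N -> (phi a).[lam v] = 0,
      forall v w, VN N v -> VN N w -> lam (v + w) = lam v + lam w,
      forall a v, VN N v -> lam (a *: v) = (phi a).[lam v]
    & forall (L : fieldType) (g : {rmorphism R -> L}),
        (forall f : {ffun 'I_s -> FA} -> L, exists p : {poly L},
           forall v, VN N v -> p.[g (lam v)] = f v) /\
        (forall p : {poly L},
           (forall v, VN N v -> p.[g (lam v)] = 0) <-> torsion_ideal N phi g p)].

(* Isomorphisms of A-modules i : V^s_N -> W, as maps on all of (F/A)^s. *)
Definition module_iso (s : nat) (N : {pred A}) (V : lmodType A) (W : set V)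
    (i : {ffun 'I_s -> FA} -> V) : Prop :=
  set_bij (VN N) W i /\
  forall a v w, VN N v -> VN N w -> i (a *: v + w) = a *: i v + i w.

Definition unit_locus (r : nat) (N : {pred A}) (rho : {ffun 'I_r -> FA} -> R) :
    set {ffun 'I_r -> FA} :=
  [set v | v = 0 \/ [/\ VN N v, v != 0 & rho v \is a GRing.unit]].

Definition inv_map (r : nat) (rho : {ffun 'I_r -> FA} -> R) :
    {ffun 'I_r -> FA} -> R :=
  fun v => if v == 0 then 0 else (rho v)^-1.

End Algebra.
End Coefficients.

(* Main.v *)
(* On [W] the map [lam = 1 / rho] is additive, and for [a] in [Div N] the
   polynomial [phi a] is a unit times the product of [X - lam u] over the
   [a]-torsion of [W]; comparing its logarithmic derivative with the second
   reciprocal relation gives [lam (a w) = phi a (lam w)], so that [W] is a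
   submodule.

   Write [N = (n)] and [#|W| = q ^ dlt].  A pigeonhole argument on elements of
   small tau-degree shows that tau-degrees are proportional to [degA], hence
   [phi] has rank [s = dlt / degA n], a priori rational.  Freeness of [W] is the
   upper bound [#|W[p]| <= #|A / p| ^ s] for the maximal ideals [p] over [n]: the
   localization [A_p] is a discrete valuation ring because [A] is an intersection
   of valuation rings, so multiplication by a uniformizer makes
   [R[tau] / (p ^ k)] grow at least like [k dim W[p]], while [p ^ k] contains an
   element of tau-degree about [k s dim (A / p)].  Therefore [W] is generated by
   the integral part of [s] elements, and counting leaves no room for relations
   beyond [N], nor for a fractional part of [s]. *)

Require Import Defs.
From HB Require Import structures.
From mathcomp Require Import all_boot all_order all_algebra.
From mathcomp Require Import pgroup finfield.
From mathcomp Require Import mathcomp_extra boolp classical_sets functions.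
From mathcomp Require Import cardinality fsbigop finmap.
From mathcomp Require Import ring zify.

Set Implicit Arguments.
Unset Strict Implicit.
Unset Printing Implicit Defensive.

Import GRing.Theory.
Local Open Scope classical_set_scope.
Local Open Scope ring_scope.

(** * Linear algebra and polynomials over commutative rings *)

(** What survives is root counting for roots whose differences are units, linear dependence of more
    vectors than coordinates, and exact degrees when the inner polynomial has a unit leading
    coefficient; the last is known at first only for divisors of [N]. Size alone does not decide
    freeness: a module with [q ^ dlt] elements may concentrate at one [p] and need many generators
    there. On the finite local part at [p], kernel and cokernel of a uniformizer have the same size,
    so [#|W[p]|] measures the number of generators needed. The pigeonhole estimate loses an error
    independent of [k]; letting [k] grow removes it, which is why whole sequences of ideals are used
    instead of single ones. *)

Section LinearIndependence.
Variable R : comNzRingType.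

(* A monic polynomial killing [M] (Cayley-Hamilton) may be divided by ['X] as
   long as its constant term vanishes, which the zero column forces. *)
Lemma injective_mx_last_col_neq0 n (M : 'M[R]_n.+1) :
  (forall v : 'rV_n.+1, v *m M = 0 -> v = 0) -> col ord_max M != 0.
Proof.
move=> injM; apply/eqP => M0.
have injM' (B : 'M_n.+1) : B * M = 0 -> B = 0.
  move=> BM0; apply/row_matrixP => i; rewrite row0; apply: injM.
  by rewrite -row_mul; move: BM0; rewrite -mulmxE => ->; rewrite row0.
have [p] := ubnP (size (char_poly M)).
have: horner_mx M (char_poly M) = 0 by exact: Cayley_Hamilton.
have: char_poly M != 0 by rewrite monic_neq0 // char_poly_monic.
move: (char_poly M) => c; elim: p c => // p IH c c0 hc; rewrite ltnS => lec.
have [q [u def_c]]: exists q u, c = q * 'X + u%:P.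
  by have := @poly_ind R (fun c => exists q u, c = q * 'X + u%:P); apply=> [|q u _];
     [exists 0, 0; rewrite mul0r addr0|exists q, u].
have hq : horner_mx M q * M + u%:M = 0.
  by rewrite -hc def_c rmorphD rmorphM /= horner_mx_X horner_mx_C.
have u0 : u = 0.
  have /(congr1 (fun B : 'M_n.+1 => B ord_max ord_max)) := hq.
  rewrite !mxE eqxx mulr1n big1 ?add0r // => i _.
  by have /colP/(_ i) := M0; rewrite !mxE => ->; rewrite mulr0.
move: hq; rewrite u0 raddf0 addr0 => /injM' hq.
move: c0 lec; rewrite def_c u0 polyC0 addr0.
have [->|q0] := eqVneq q 0; first by rewrite mul0r eqxx.
move=> _; rewrite size_mulX // => ltq.
exact: (IH q q0 hq ltq).
Qed.

(** Padding the rows with zeros gives a square matrix whose last column vanishes, so it cannot be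
    injective. *)
Lemma linear_dependence (I : finType) n (G : I -> 'I_n -> R) :
  (n < #|I|)%N ->
  exists2 r : I -> R, exists i, r i != 0 & forall j, \sum_i r i * G i j = 0.
Proof.
case cI: #|I| => [//|m]; rewrite ltnS => len.
pose M := \matrix_(i < m.+1, j < m.+1)
  oapp (G (enum_val (cast_ord (esym cI) i))) 0 (insub (val j)).
have : col ord_max M == 0.
  apply/eqP/colP => i; rewrite !mxE insubF //=.
  by apply/negbTE; rewrite -leqNgt.
apply: contraPP => no; apply/negP/injective_mx_last_col_neq0 => v vM0.
apply: contrapT => /eqP /rV0Pn [i0 vi0]; apply: no.
exists (fun i => v 0 (cast_ord cI (enum_rank i))).
  by exists (enum_val (cast_ord (esym cI) i0)); rewrite enum_valK cast_ordKV.
move=> j; have /rowP/(_ (widen_ord (leqW len) j)) := vM0; rewrite !mxE => {2}<-.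
rewrite (reindex (fun k => enum_val (cast_ord (esym cI) k))) /=; last first.
  exists (fun i => cast_ord cI (enum_rank i)) => k _.
    by rewrite enum_valK cast_ordKV.
  by rewrite cast_ordK enum_rankK.
apply: eq_bigr => k _; rewrite enum_valK cast_ordKV mxE; congr (_ * _).
by rewrite (valK j : insub (val j) = Some j).
Qed.

End LinearIndependence.

Section Polynomials.
Variable R : comUnitRingType.
Implicit Types p q : {poly R}.

(** A unit leading coefficient of the inner polynomial keeps the top term alive, whatever zero
    divisors occur in [p]. *)
Lemma size_lead_coef_comp p q : lead_coef q \is a GRing.unit -> (1 < size q)%N ->
  p != 0 ->
  size (p \Po q) = ((size p).-1 * (size q).-1).+1 /\
  lead_coef (p \Po q) = lead_coef p * lead_coef q ^+ (size p).-1.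
Proof.
move=> uq q1; elim/poly_ind: p => [|p c IH]; first by rewrite eqxx.
have [-> {IH}|p0 _] := eqVneq p 0.
  rewrite mul0r add0r polyC_eq0 => c0.
  by rewrite comp_polyC size_polyC c0 lead_coefC /= expr0 mulr1.
have [sz lc] := IH p0.
have sp : (0 < size p)%N by rewrite size_poly_gt0.
have pq0 : lead_coef (p \Po q) * lead_coef q != 0.
  rewrite (can2_eq (mulrK uq) (divrK uq)) mul0r lc.
  by rewrite (can2_eq (mulrK (unitrX _ uq)) (divrK (unitrX _ uq))) mul0r lead_coef_eq0.
have szD : (size (c%:P : {poly R}) < size (p * 'X)%R)%N.
  by rewrite size_mulX // ltnS (leq_trans (size_polyC_leq1 _)).
have szD' : (size (c%:P : {poly R}) < size ((p \Po q) * q)%R)%N.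
  rewrite size_proper_mul // sz; apply: leq_ltn_trans (size_polyC_leq1 _) _.
  by case: (size q) q1 => [|[|k]] // _; rewrite addnS /= addnS.
rewrite comp_polyD comp_polyM comp_polyX comp_polyC.
rewrite (size_polyDl szD) (size_polyDl szD') (lead_coefDl szD) (lead_coefDl szD').
rewrite (size_proper_mul pq0) (size_mulX p0)
  (lead_coef_proper_mul pq0) lc sz lead_coefMX; split; last first.
  by rewrite -mulrA -exprSr prednK.
case: (size p) sp => // k _; case: (size q) q1 => // l _.
by rewrite addSn addnS /= mulSn addnC.
Qed.

Lemma comp_poly_lreg p q : lead_coef q \is a GRing.unit -> (1 < size q)%N ->
  p \Po q = 0 -> p = 0.
Proof.
move=> uq q1 pq0; apply/eqP; apply/negPn/negP => p0.
have [+ _] := size_lead_coef_comp uq q1 p0.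
by rewrite pq0 size_poly0.
Qed.

(** [uniq_roots] is the condition under which roots can be counted over a ring: their differences
    are units, not merely non-zero. *)
Lemma uniq_roots_map (T : eqType) (f : T -> R) (s : seq T) : uniq s ->
  {in s &, forall x y, x != y -> f x - f y \is a GRing.unit} ->
  uniq_roots [seq f x | x <- s].
Proof.
elim: s => //= x s IH /andP[xs us] fs; rewrite IH ?andbT //; last first.
  by move=> y z ys zs; apply: fs; rewrite inE (ys, zs) orbT.
apply/allP => _ /mapP[y ys ->]; rewrite /diff_roots mulrC eqxx /=.
by apply: fs; rewrite ?inE ?eqxx ?ys ?orbT //; apply: contraNneq xs => <-.
Qed.

Lemma horner_deriv_prod_XsubC (s : seq R) t :
  all (fun u => t - u \is a GRing.unit) s ->
  (\prod_(u <- s) ('X - u%:P))^`().[t] =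
  (\prod_(u <- s) (t - u)) * \sum_(u <- s) (t - u)^-1.
Proof.
elim: s => [|u s IH] /=; first by rewrite !big_nil mulr0 derivC horner0.
move=> /andP[tu ts]; rewrite !big_cons derivM hornerD !hornerM derivB derivX derivC.
rewrite subr0 hornerC mul1r IH // hornerXsubC horner_prod.
under eq_bigr do rewrite hornerXsubC.
by rewrite mulrDr mulrA; congr (_ + _); rewrite mulrAC divrr // mul1r.
Qed.

End Polynomials.

Lemma pcharf_nat_card (K : finFieldType) (S : nzRingType)
  (f : {rmorphism K -> S}) : [pchar S].-nat #|K|.
Proof.
have [p _ pK] := finPcharP K; have pS := rmorph_pchar f pK.
rewrite (eq_pnat _ (pcharf_eq pS)).
by have := pprimeChar_pgroup pK; rewrite /pgroup cardsT.
Qed.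

(** * Tau-polynomials and Frobenius *)

Section TauPolynomials.
Variables (K : finFieldType) (F : fieldType) (R : comUnitAlgType F).
Variable f0 : {rmorphism K -> R}.
Notation q := #|K|.
Implicit Types p : {poly R}.

Let q_gt1 : (1 < q)%N := finNzRing_gt1 K.
Let q_gt0 : (0 < q)%N := ltnW q_gt1.

Lemma exprDq (x y : {poly R}) j :
  (x + y) ^+ (q ^ j) = x ^+ (q ^ j) + y ^+ (q ^ j).
Proof. by rewrite exprDn_pchar // pnatX (pcharf_nat_card (polyC \o f0)). Qed.

Lemma tau_polyD p1 p2 : tau_poly K p1 -> tau_poly K p2 -> tau_poly K (p1 + p2).
Proof.
move=> t1 t2 n; rewrite coefD; have [->|/t1//] := eqVneq p1`_n 0.
by rewrite add0r => /t2.
Qed.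

Lemma tau_polyZ c p : tau_poly K p -> tau_poly K (c *: p).
Proof.
move=> tp n; rewrite coefZ; have [->|/tp//] := eqVneq p`_n 0.
by rewrite mulr0 eqxx.
Qed.

Lemma tau_poly_sum (I : Type) (s : seq I) (f : I -> {poly R}) :
  (forall i, tau_poly K (f i)) -> tau_poly K (\sum_(i <- s) f i).
Proof.
move=> tf; elim: s => [|i s IH]; first by rewrite big_nil => n; rewrite coef0 eqxx.
by rewrite big_cons; apply: tau_polyD.
Qed.

Lemma tau_polyXq i : tau_poly K ('X^(q ^ i) : {poly R}).
Proof. by move=> n; rewrite coefXn; have [ni|] := eqVneq n (q ^ i)%N; [exists i|rewrite eqxx]. Qed.

Lemma tau_polyE p m : tau_poly K p -> (size p <= (q ^ m).+1)%N ->
  p = \sum_(i < m.+1) p`_(q ^ i) *: 'X^(q ^ i).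
Proof.
move=> tp sp; apply/polyP => n; rewrite coef_sum.
under eq_bigr do rewrite coefZ coefXn.
have [[i ->]|no] := pselect (exists i, n = q ^ i)%N; last first.
  rewrite big1 => [|i _]; last by case: eqP => [ni|_]; [case: no; exists i|rewrite mulr0].
  by apply/eqP/negPn/negP => /tp.
have [ltim|leim] := ltnP i m.+1.
  rewrite (bigD1 (Ordinal ltim)) //= eqxx mulr1 big1 ?addr0 // => j ji.
  by rewrite eqn_exp2l // eq_sym -(inj_eq val_inj) /= in ji *; rewrite (negbTE ji) mulr0.
rewrite big1 => [|j _].
  by rewrite nth_default // (leq_trans sp) // ltn_exp2l.
rewrite eqn_exp2l //; case: eqP => [ij|_]; last by rewrite mulr0.
by move: (ltn_ord j); rewrite -ij ltnNge leim.
Qed.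

Lemma tau_poly_size p : tau_poly K p -> p != 0 -> exists m, size p = (q ^ m).+1.
Proof.
move=> tp p0; have := tp (size p).-1; rewrite -lead_coefE lead_coef_eq0 => /(_ p0)[m sp].
by exists m; rewrite -sp prednK // size_poly_gt0.
Qed.

Lemma tau_poly_coef0 p : tau_poly K p -> p`_0 = 0.
Proof.
move=> tp; apply/eqP/negPn/negP => /tp[i] /esym/eqP.
by rewrite expn_eq0 (gtn_eqF q_gt0).
Qed.

Lemma tau_poly_horner0 p : tau_poly K p -> p.[0] = 0.
Proof. by move=> tp; rewrite horner_coef0 tau_poly_coef0. Qed.

Lemma natr_card_eq0 : q%:R = 0 :> R.
Proof.
have [p _ pK] := finPcharP K; have pR := rmorph_pchar f0 pK.
have := pprimeChar_pgroup pK; rewrite /pgroup cardsT => /p_natP[[|m] qp].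
  by move: q_gt1; rewrite qp.
by rewrite qp expnS natrM (pcharf0 pR) mul0r.
Qed.

(** All exponents except [1] are multiples of [q], which is zero in [R]. This turns the chain rule
    and logarithmic derivatives into identities about linear coefficients. *)
Lemma deriv_tau_poly p : tau_poly K p -> p^`() = (p`_1)%:P.
Proof.
move=> tp; apply/polyP => -[|n]; rewrite coef_deriv coefC //=.
have [->|/tp[[|i]]//] := eqVneq p`_n.+2 0; first by rewrite mul0rn.
by move=> ->; rewrite -mulr_natr expnS natrM natr_card_eq0 mul0r mulr0.
Qed.

Lemma tau_poly_exprq p j : tau_poly K p -> tau_poly K (p ^+ (q ^ j)).
Proof.
move=> tp; have [m lepm] : exists m, (size p <= (q ^ m).+1)%N.
  by exists (size p); rewrite leqW // ltnW // ltn_expl.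
rewrite (tau_polyE tp lepm).
elim: (index_enum _) => [|i s IH].
  by rewrite big_nil expr0n expn_eq0 (gtn_eqF q_gt0) => n; rewrite coef0 eqxx.
rewrite big_cons exprDq; apply: tau_polyD IH.
by rewrite exprZn -exprM -expnD; apply/tau_polyZ/tau_polyXq.
Qed.

End TauPolynomials.

(** * Degrees and tau-degrees *)

Section CoefficientRing.
Variables (F : fieldType) (Oinf : set F).
Notation A := (coef_ring Oinf).
Implicit Types (a b x y z : A) (I J : set A).

Lemma coef_ringI a : a != 0 -> injective ( *%R a).
Proof.
move=> a0 x y /(congr1 val); rewrite !rmorphM => /mulfI axy.
by apply/val_inj/axy; rewrite -(rmorph0 (val : A -> F)) (inj_eq val_inj).
Qed.

Lemma coef_ring_mul_eq0 a b : (a * b == 0) = (a == 0) || (b == 0).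
Proof.
by rewrite -!(inj_eq val_inj) rmorphM rmorph0 mulf_eq0.
Qed.

Lemma coef_ring_expf_neq0 a k : a != 0 -> a ^+ k != 0.
Proof.
move=> a0; elim: k => [|k IH]; first by rewrite expr0 oner_eq0.
by rewrite exprS coef_ring_mul_eq0 negb_or a0.
Qed.

(* [A / I] has at most [m] elements. *)
Definition index_le I m := exists (Z : finType) (f : A -> Z),
  (#|Z| <= m)%N /\ forall x y, f x = f y -> I (x - y).

(** Subtracting a representative of its class modulo [I] moves any element into [I], the only place
    where [g] has to separate classes modulo [J]. *)
Lemma index_le_chain I J m m' : index_le I m ->
  (exists (Z : finType) (g : A -> Z), (#|Z| <= m')%N /\
     forall x y, I x -> I y -> g x = g y -> J (x - y)) ->
  index_le J (m * m').
Proof.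
move=> [Z [f [Zm fI]]] [Z' [g [Zm' gJ]]].
pose rep (z : Z) : A :=
  if pselect (exists x, f x = z) is left ex then projT1 (cid ex) else 0.
have repP x : f (rep (f x)) = f x.
  by rewrite /rep; case: pselect => [ex|[]]; [case: cid|exists x].
exists (Z * Z')%type, (fun x => (f x, g (x - rep (f x)))); split.
  by rewrite card_prod leq_mul.
move=> x y [fxy]; rewrite -fxy => /gJ.
have -> : x - rep (f x) - (y - rep (f x)) = x - y.
  by rewrite opprB addrA subrK.
by apply; apply: fI; rewrite repP.
Qed.

Lemma index_le_pigeonhole I m (Y : finType) (g : Y -> A) :
  index_le I m -> (m < #|Y|)%N -> exists t t', t != t' /\ I (g t - g t').
Proof.
move=> [Z [f [Zm fI]]] Ym.
have /injectivePn[y [y' yy' fgy]] : ~~ injectiveb (f \o g).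
  apply: contraL (leq_ltn_trans Zm Ym) => /injectiveP inj.
  by rewrite -leqNgt; apply: leq_card inj.
by exists y, y'; split=> //; apply: fI.
Qed.

Section Degree.
Variables (K : finFieldType) (iota : {rmorphism K -> A}).
Notation q := #|K|.

Lemma degA_residues a d : degA_is iota a d ->
  exists (f : A -> {ffun 'I_d -> K}) (rep : {ffun 'I_d -> K} -> A),
    (forall x y, f x = f y <-> exists z, x - y = a * z) /\ cancel rep f.
Proof.
move=> [_ [e eP]].
pose rep (c : {ffun 'I_d -> K}) := \sum_(i < d) iota (c i) * e i.
have {}eP x : exists! c, exists z, x - rep c = a * z by exact: eP.
have [f fP] := choice eP.
have fK c : f (rep c) = c.
  by have [_] := fP (rep c); apply; exists 0; rewrite subrr mulr0.
exists f, rep; split=> // x y; have [[z xz] _] := fP x; have [[t yt] uy] := fP y.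
split=> [fxy|[u xyu]].
  exists (z - t); rewrite mulrBr -xz -yt fxy. ring.
apply/esym/uy; exists (z - u); rewrite mulrBr -xz -xyu; ring.
Qed.

Lemma degA_inj a d d' : degA_is iota a d -> degA_is iota a d' -> d = d'.
Proof.
suff le d1 d2 : degA_is iota a d1 -> degA_is iota a d2 -> (d1 <= d2)%N.
  by move=> da da'; apply/eqP; rewrite eqn_leq !le.
move=> /degA_residues[f [rep [fP repK]]] /degA_residues[f' [rep' [fP' _]]].
have /leq_card : injective (f' \o rep).
  by move=> c c' /fP' /fP; rewrite !repK.
by rewrite !card_ffun !card_ord leq_exp2l // finNzRing_gt1.
Qed.

(** Division by [b ^+ k] embeds [b ^+ k A / b ^+ k.+1 A] into [A / b], which has [q ^ d] elements;
    [quo] is this division, extended by zero. *)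
Lemma degA_pow_index_le b d k : degA_is iota b d ->
  index_le [set x | exists z, x = b ^+ k * z] (q ^ (k * d)).
Proof.
move=> db; have b0 : b != 0 by case: db.
have [f [rep [fP _]]] := degA_residues db.
elim: k => [|k IH].
  exists unit, (fun=> tt); rewrite card_unit; split=> // x y _.
  by exists (x - y); rewrite expr0 mul1r.
rewrite mulSn addnC expnD; apply: index_le_chain IH _.
pose quo x : A := if pselect (exists z, x = b ^+ k * z) is left ex
  then projT1 (cid ex) else 0.
exists {ffun 'I_d -> K}, (f \o quo); rewrite card_ffun card_ord; split=> //.
move=> x y Ix Iy /fP[u]; rewrite /quo.
case: pselect => // ?; case: cid => z xz /=.
case: pselect => // ?; case: cid => t yt /= ztu.
by exists u; rewrite xz yt -mulrBr ztu exprSr mulrA.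
Qed.

Variables (R : comUnitAlgType F) (phi : A -> {poly R}).
Hypothesis phiP : tau_hom iota phi.

Definition tau_deg_le a m := (size (phi a) <= (q ^ m).+1)%N.

Let q_gt1 : (1 < q)%N := finNzRing_gt1 K.
Let phi_tau a : tau_poly K (phi a). Proof. by case: phiP. Qed.
Let phiD a b : phi (a + b) = phi a + phi b. Proof. by case: phiP. Qed.
Let phiM a b : phi (a * b) = phi a \Po phi b. Proof. by case: phiP. Qed.

Lemma tau_hom0 : phi 0 = 0.
Proof. by apply: (addIr (phi 0)); rewrite -phiD !add0r. Qed.

Lemma tau_deg_leW a m m' : (m <= m')%N -> tau_deg_le a m -> tau_deg_le a m'.
Proof. by move=> mm' /leq_trans; apply; rewrite ltnS leq_pexp2l // ltnW. Qed.

Lemma tau_deg_leD a b m : tau_deg_le a m -> tau_deg_le b m -> tau_deg_le (a + b) m.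
Proof.
move=> ha hb; rewrite /tau_deg_le phiD (leq_trans (size_polyD _ _)) //.
by rewrite geq_max; apply/andP.
Qed.

Lemma tau_deg_leB a b m : tau_deg_le a m -> tau_deg_le b m -> tau_deg_le (a - b) m.
Proof.
move=> ha hb; apply: tau_deg_leD => //; rewrite /tau_deg_le.
suff -> : phi (- b) = - phi b by rewrite size_polyN.
by apply/eqP; rewrite -subr_eq0 opprK -phiD addNr tau_hom0.
Qed.

Lemma tau_deg_leM a b m m' :
  tau_deg_le a m -> tau_deg_le b m' -> tau_deg_le (a * b) (m + m').
Proof.
move=> ha hb; rewrite /tau_deg_le phiM (leq_trans (size_comp_poly_leq _ _)) //.
by rewrite ltnS expnD leq_mul // -subn1 leq_subLR add1n.
Qed.

Lemma tau_deg_le_bounded a : exists m, tau_deg_le a m.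
Proof. by exists (size (phi a)); apply/leqW/ltnW/ltn_expl. Qed.

Lemma tau_deg_le_fin_bounded (T : finType) (f : T -> A) :
  exists m, forall t, tau_deg_le (f t) m.
Proof.
have [g gP] := choice (fun t => tau_deg_le_bounded (f t)).
by exists (\max_t g t) => t; apply: tau_deg_leW (gP t); apply: leq_bigmax.
Qed.

(** These are expansions with [j] digits in base [c]: digits are unique as residues modulo [c], [m0]
    bounds the tau-degree of a digit, and each factor [c] adds [dlt]. *)
Lemma many_small_elements c dc dlt : degA_is iota c dc -> tau_deg_le c dlt ->
  exists m0, forall j, exists (Y : finType) (g : Y -> A),
    [/\ #|Y| = (q ^ (j * dc))%N, injective g
      & forall t, tau_deg_le (g t) (m0 + j * dlt)].
Proof.
move=> dcP cdlt; have c0 : c != 0 by case: dcP.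
have [f [rep [fP repK]]] := degA_residues dcP.
have [m0 m0P] := tau_deg_le_fin_bounded rep.
exists m0; elim=> [|j [Y [g [Yq gI gdlt]]]].
  exists unit, (fun=> 0); rewrite card_unit; split=> // [[] []//|y].
  by rewrite /tau_deg_le tau_hom0 size_poly0.
exists ({ffun 'I_dc -> K} * Y)%type, (fun t => rep t.1 + c * g t.2); split.
- by rewrite card_prod card_ffun card_ord Yq -expnD mulSn.
- move=> [u y] [u' y'] /= eq_g.
  have uu' : u = u'.
    rewrite -[u]repK -[u']repK; apply/fP; exists (g y' - g y).
    by rewrite mulrBr -[rep u](addrK (c * g y)) eq_g; ring.
  by move: eq_g; rewrite uu' => /addrI /(coef_ringI c0) /gI ->.
move=> y; apply: tau_deg_leD.
  by apply: tau_deg_leW (m0P _); rewrite leq_addr.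
by rewrite mulSn addnCA; apply: tau_deg_leM.
Qed.

(* Pigeonhole: if [A / J_k] has at most [q^(k h)] elements, then [J_k] contains
   a non-zero element of tau-degree about [k h (dlt / dc)]. *)
Lemma slope_le c dc dlt (J : nat -> set A) h g :
  degA_is iota c dc -> tau_deg_le c dlt ->
  (forall k, index_le (J k) (q ^ (k * h))) ->
  (forall k a m, J k a -> a != 0 -> tau_deg_le a m -> (k * g <= m)%N) ->
  (g * dc <= dlt * h)%N.
Proof.
move=> dcP cdlt Jh Jg; have [->|dc_gt0] := posnP dc; first by rewrite muln0.
have [m0 small] := many_small_elements dcP cdlt.
have bnd k : (k * g * dc <= (m0 + dlt) * dc + k * (dlt * h))%N.
  (* The least number of digits for which the expansions outnumber [q ^ (k * h)]. *)
  pose j := (k * h %/ dc).+1.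
  have [Y [G [Yq GI Gdlt]]] := small j.
  have [|y [y' [yy' Jy]]] := index_le_pigeonhole G (Jh k).
    by rewrite Yq ltn_exp2l // /j -ltn_divLR.
  have := Jg _ _ (m0 + j * dlt)%N Jy; rewrite subr_eq0 (inj_eq GI).
  move=> /(_ yy' (tau_deg_leB (Gdlt _) (Gdlt _))) le1.
  apply: leq_trans (leq_mul le1 (leqnn dc)) _.
  have := leq_mul (leqnn dlt) (leq_divM (k * h) dc).
  by rewrite /j; move: (_ %/ _)%N => l; lia.
(* The error [w = (m0 + dlt) * dc] in [bnd] does not depend on [k], so an excess of [g * dc] over
   [dlt * h] contradicts [bnd] at [k = w.+1]. *)
rewrite leqNgt; apply/negP => lt.
have := bnd ((m0 + dlt) * dc).+1.
rewrite -mulnA; move: lt; set u := (g * dc)%N; set v := (dlt * h)%N.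
set w := ((m0 + dlt) * dc)%N => lt.
rewrite leqNgt => /negP; apply.
apply: leq_trans (_ : (w.+1 * v.+1 <= _))%N; last by rewrite leq_mul2l.
by rewrite mulnS ltn_add2r.
Qed.

End Degree.
End CoefficientRing.

(** * Generation of [A] by [D], and comparison of tau-degree with [degA] *)

Section LevelGeneration.
Variables (K : finFieldType) (F : fieldType) (Oinf : set F).
Notation A := (coef_ring Oinf).
Variables (iota : {rmorphism K -> A}) (D : set A).
Hypothesis level_approx : forall a, a != 0 ->
  exists b, [/\ b != 0, product_of D b & degA_lt iota (a - b) a].

Lemma level_degA a : a != 0 -> exists d, degA_is iota a d.
Proof. by move=> /level_approx[b [_ _ [d ad _]]]; exists d. Qed.

(** Descent on [degA], splitting off a product of elements of [D] each time. The last case retains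
    the strict drop in degree, which is needed to exclude cancellation of leading terms. *)
Lemma level_ind (P : A -> Prop) :
  P 0 -> (forall b, b != 0 -> product_of D b -> P b) ->
  (forall a b d, a != 0 -> b != 0 -> product_of D b -> a + b != 0 ->
     degA_is iota (a + b) d -> (exists2 d', degA_is iota a d' & (d' < d)%N) ->
     P a -> P (a + b)) ->
  forall a, P a.
Proof.
move=> P0 Pprod Padd a; have [->//|a0] := eqVneq a 0.
have [d ad] := level_degA a0.
elim/ltn_ind: d a ad a0 => d IH a ad a0.
have [b [b0 Db [d0 ad0 lt]]] := level_approx a0.
rewrite (degA_inj ad0 ad) in lt.
case: lt => [/eqP|[d' abd' ltd']].
  by rewrite subr_eq0 => /eqP ->; apply: Pprod.
have ab0 : a - b != 0 by case: abd'.
rewrite -[a](subrK b); apply: (Padd _ _ d) => //; rewrite ?subrK //.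
  by exists d'.
exact: IH abd' ab0.
Qed.

(** Sums of products of elements of [D] exhaust [A], so properties of [phi] need only be checked on
    divisors of [N], where the product formula is available. *)
Lemma level_ring_ind (P : A -> Prop) :
  P 0 -> P 1 -> (forall a, D a -> P a) ->
  (forall a b, P a -> P b -> P (a + b)) ->
  (forall a b, P a -> P b -> P (a * b)) ->
  forall a, P a.
Proof.
move=> P0 P1 PD Padd Pmul.
have Pprod b : product_of D b -> P b.
  move=> [s sD ->]; elim: s sD => [|x s IH] sD; first by rewrite big_nil.
  rewrite big_cons; apply: Pmul; first by apply/PD/sD; rewrite inE eqxx.
  by apply: IH => y ys; apply: sD; rewrite inE ys orbT.
apply: level_ind => // [b _ /Pprod//|a b _ _ _ /Pprod Pb _ _ _ Pa].
exact: Padd.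
Qed.

Section Rank.
Variables (R : comUnitAlgType F) (phi : A -> {poly R}).
Hypothesis phiP : tau_hom iota phi.
Hypothesis phi_lin : forall a, (phi a)`_1 = (val a)%:A.
Notation q := #|K|.
Notation tau_deg_le := (tau_deg_le K phi).

Definition unit_lead a m :=
  size (phi a) = (q ^ m).+1 /\ lead_coef (phi a) \is a GRing.unit.

Let q_gt1 : (1 < q)%N := finNzRing_gt1 K.
Let phi_tau a : tau_poly K (phi a). Proof. by case: phiP. Qed.
Let phiD a b : phi (a + b) = phi a + phi b. Proof. by case: phiP. Qed.
Let phiM a b : phi (a * b) = phi a \Po phi b. Proof. by case: phiP. Qed.

Lemma tau_hom_neq0 a : a != 0 -> phi a != 0.
Proof.
move=> a0; apply/eqP => pa0; have /esym/eqP := phi_lin a; rewrite pa0 coef0.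
rewrite scaler_eq0 oner_eq0 orbF.
by rewrite -(rmorph0 (val : A -> F)) (inj_eq val_inj) (negbTE a0).
Qed.

Lemma tau_hom1 : phi 1 = 'X.
Proof.
have [_ _ _ /(_ 1)] := phiP; rewrite !rmorph1 => ->.
by rewrite !scale1r.
Qed.

Lemma unit_lead1 : unit_lead 1 0.
Proof. by rewrite /unit_lead tau_hom1 size_polyX lead_coefX unitr1. Qed.

Lemma unit_lead_size_gt1 a m : unit_lead a m -> (1 < size (phi a))%N.
Proof. by move=> [-> _]; rewrite ltnS expn_gt0 ltnW. Qed.

Lemma unit_leadM a b m m' : unit_lead a m -> unit_lead b m' ->
  unit_lead (a * b) (m + m').
Proof.
move=> [sa ua] ub; rewrite /unit_lead phiM.
have a0 : phi a != 0 by rewrite -size_poly_gt0 sa.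
have [-> ->] := size_lead_coef_comp ub.2 (unit_lead_size_gt1 ub) a0.
by rewrite sa ub.1 /= -expnD unitrM ua unitrX // ub.2.
Qed.

Lemma unit_leadX b m k : unit_lead b m -> unit_lead (b ^+ k) (k * m).
Proof.
move=> ub; elim: k => [|k IH]; first exact: unit_lead1.
by rewrite exprS mulSn; apply: unit_leadM.
Qed.

Lemma unit_lead_deg_le a m m' : unit_lead a m -> tau_deg_le a m' -> (m <= m')%N.
Proof. by move=> [sa _]; rewrite /tau_deg_le sa ltnS leq_exp2l. Qed.

Lemma unit_lead_tau_deg_le a m : unit_lead a m -> tau_deg_le a m.
Proof. by move=> [sa _]; rewrite /tau_deg_le sa. Qed.

(** Composing with [phi b] on the inside multiplies degrees exactly, although the leading
    coefficient of [phi z] is unknown; [phi z] is non-zero because of its linear coefficient. *)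
Lemma unit_lead_dvd b z l m : unit_lead b l -> z != 0 ->
  tau_deg_le (b * z) m -> (l <= m)%N.
Proof.
move=> ub /tau_hom_neq0 z0; rewrite /tau_deg_le mulrC phiM.
have [-> _] := size_lead_coef_comp ub.2 (unit_lead_size_gt1 ub) z0.
have [k ->] := tau_poly_size (@phi_tau z) z0.
by rewrite ub.1 /= ltnS -expnD leq_exp2l //; apply: leq_trans; rewrite leq_addl.
Qed.

Lemma unit_lead_slope_le b l db c dc dlt : unit_lead b l -> degA_is iota b db ->
  degA_is iota c dc -> tau_deg_le c dlt -> (l * dc <= dlt * db)%N.
Proof.
move=> ub dbP dcP cdlt.
apply: (@slope_le _ _ _ _ _ _ phiP c dc dlt
  (fun k => [set x | exists z, x = b ^+ k * z])) => // [k|k a m [z ->] bz0].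
  exact: degA_pow_index_le dbP.
apply: unit_lead_dvd (unit_leadX k ub) _; apply: contraNneq bz0 => ->.
by rewrite mulr0.
Qed.

Lemma unit_leadD a b m m' : unit_lead a m -> tau_deg_le b m' -> (m' < m)%N ->
  unit_lead (a + b) m.
Proof.
move=> [sa ua] hb lt.
have szlt : (size (phi b) < size (phi a))%N.
  by rewrite sa (leq_ltn_trans hb) // ltnS ltn_exp2l.
by split; rewrite phiD ?(size_polyDl szlt) // (lead_coefDl szlt).
Qed.

Variables (n : A) (dlt dn : nat).
Hypotheses (D_lead : forall a, D a -> exists m, unit_lead a m)
  (n_lead : unit_lead n dlt) (dlt_gt0 : (0 < dlt)%N) (dnP : degA_is iota n dn).

(** The slope inequality between [a] and [n] applies in both directions, as both have unit leading
    coefficients. *)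
Lemma unit_lead_degA a m d : unit_lead a m -> degA_is iota a d ->
  (m * dn = dlt * d)%N.
Proof.
move=> ua ad; apply/eqP; rewrite eqn_leq.
rewrite (unit_lead_slope_le ua ad dnP (unit_lead_tau_deg_le n_lead)).
by rewrite (unit_lead_slope_le n_lead dnP ad (unit_lead_tau_deg_le ua)).
Qed.

(* [degA] is not known to be ultrametric: write [a + b] with [b] a product of
   elements of [D]; if the tau-degrees of [a] and [b] agree, that of [a + b] is
   too small for the slope inequality. *)
Lemma unit_lead_all a : a != 0 -> exists m d,
  [/\ unit_lead a m, degA_is iota a d & (m * dn = dlt * d)%N].
Proof.
have prod_lead b : product_of D b -> exists m, unit_lead b m.
  move=> [s sD ->]; elim: s sD => [|x s IH] sD.
    by rewrite big_nil; exists 0%N; apply: unit_lead1.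
  have [|m xm] := D_lead (a := x); first by apply: sD; rewrite inE eqxx.
  have [|m' sm'] := IH; first by move=> y ys; apply: sD; rewrite inE ys orbT.
  by exists (m + m')%N; rewrite big_cons; apply: unit_leadM.
have wrap b m d : unit_lead b m -> degA_is iota b d -> exists m d,
    [/\ unit_lead b m, degA_is iota b d & (m * dn = dlt * d)%N].
  by move=> bm bd; exists m, d; split=> //; apply: unit_lead_degA bm bd.
move: a; apply: level_ind => [|b b0 /prod_lead[m bm] _|].
- by rewrite eqxx.
- by have [d bd] := level_degA b0; apply: wrap bm bd.
move=> a b d a0 b0 /prod_lead[mb bm] ab0 abd [d' ad' ltd] /(_ a0)[m [d2 [am ad2 eqm]]] _.
rewrite {d2 ad2}(degA_inj ad2 ad') in eqm.
(* Were [dn] zero, the slope inequality of [n] against [a + b] would give [dlt * d <= 0], whereas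
   [d] exceeds [d']. *)
have dn_gt0 : (0 < dn)%N.
  have [d0|//] := posnP dn; have := unit_lead_degA am ad'; rewrite d0 muln0.
  have := unit_lead_slope_le n_lead dnP abd.
  have [l abl] := tau_deg_le_bounded K phi (a + b) => /(_ _ abl).
  by rewrite d0 muln0 leqn0 muln_eq0 !gtn_eqF // (leq_ltn_trans _ ltd).
have [lt|lt|eq_m] := ltngtP m mb.
- apply: wrap abd; rewrite addrC; apply: unit_leadD bm (unit_lead_tau_deg_le am) lt.
- have abm := unit_leadD am (unit_lead_tau_deg_le bm) lt.
  exact: wrap abm abd.
have abm : tau_deg_le (a + b) m.
  apply: (tau_deg_leD phiP) (unit_lead_tau_deg_le am) _.
  by rewrite eq_m; apply: unit_lead_tau_deg_le.
have := unit_lead_slope_le n_lead dnP abd abm.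
by rewrite eqm leq_pmul2l // leqNgt ltd.
Qed.

End Rank.
End LevelGeneration.

(** * Localization at a maximal ideal *)

Section MaximalIdeals.
Variables (K : finFieldType) (F : fieldType) (Oinf : set F).
Notation A := (coef_ring Oinf).
Variable iota : {rmorphism K -> A}.
Notation q := #|K|.
Implicit Types (O : set F) (a b u v x y : A).

Lemma place_ring O : place O ->
  [/\ O 1, forall x y : F, O x -> O y -> O (x - y)
    & forall x y : F, O x -> O y -> O (x * y)].
Proof.
move=> [[O1 OB OM] _ _]; split; first exact: (set_mem O1).
  by move=> x y Ox Oy; apply/set_mem/OB; apply/mem_set.
by move=> x y Ox Oy; apply/set_mem/OM; apply/mem_set.
Qed.

(* An element of least valuation. *)
Lemma place_dominant O (s : seq F) (x : F) : place O ->
  all (fun g => g != 0) (x :: s) ->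
  exists2 g, g \in x :: s & forall h, h \in x :: s -> O (h / g).
Proof.
move=> pO; have [O1 OB OM] := place_ring pO; have [_ _ Oval] := pO.
elim: s x => [|y s IH] x.
  move=> /= /andP[x0 _]; exists x; rewrite ?mem_head // => h.
  by rewrite mem_seq1 => /eqP ->; rewrite divff.
move=> /= /andP[x0 ys0]; have [g gs gP] := IH y ys0.
have g0 : g != 0 by have /(@allP _ _ (y :: s))/(_ _ gs) := ys0.
have [Oxg|Ogx] := Oval (x / g).
  exists g; first by rewrite inE gs orbT.
  by move=> h; rewrite inE => /orP[/eqP ->|/gP].
exists x; first exact: mem_head.
move=> h; rewrite inE => /orP[/eqP ->|/gP Ohg]; first by rewrite divff.
by have := OM _ _ Ohg Ogx; rewrite invf_div mulrA divfK.
Qed.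

Lemma regular_place O x : place O -> O <> Oinf -> O (val x).
Proof. by move=> pO OO; have /asboolP/(_ O pO OO) := valP x. Qed.

Record maximal_ideal (p : set A) : Prop := MaximalIdeal {
  maxB : forall x y, p x -> p y -> p (x - y);
  maxM : forall a x, p x -> p (a * x);
  max1 : ~ p 1;
  max_inv : forall x, ~ p x -> exists y, p (1 - x * y)
}.

Section OneIdeal.
Variables (n : A) (dn : nat) (p : set A).
Hypotheses (dnP : degA_is iota n dn) (pP : maximal_ideal p) (pn : p n).

Lemma power_period x : exists i j, (i < j)%N /\ exists z, x ^+ i - x ^+ j = n * z.
Proof.
have [f [rep [fP repK]]] := degA_residues dnP.
have /injectivePn[i [j ij fij]] :
    ~~ injectiveb (fun i : 'I_(#|{ffun 'I_dn -> K}|.+1) => f (x ^+ i)).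
  by apply/negP => /injectiveP /leq_card; rewrite card_ord ltnn.
have [lt|lt|/val_inj eq] := ltngtP i j.
- by exists i, j; split=> //; apply/fP.
- by exists j, i; split=> //; apply/fP.
- by rewrite eq eqxx in ij.
Qed.

Lemma max0 : p 0. Proof. by rewrite -(subrr n); apply: maxB. Qed.

Lemma maxD x y : p x -> p y -> p (x + y).
Proof.
move=> px py; rewrite -[y]opprK; apply: maxB => //; rewrite -sub0r.
by apply: maxB => //; apply: max0.
Qed.

Lemma max_prime x y : ~ p x -> ~ p y -> ~ p (x * y).
Proof.
move=> px py pxy; have [x' px'] := max_inv pP px; apply: py.
have -> : y = y * (1 - x * x') + x' * (x * y) by ring.
by apply: maxD; apply: maxM.
Qed.

Lemma max_primeX x k : ~ p x -> ~ p (x ^+ k).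
Proof.
move=> px; elim: k => [|k IH]; first by rewrite expr0; apply: max1.
by rewrite exprS; apply: max_prime.
Qed.

Lemma max_dvd x y z : p x -> x - y = n * z -> p y.
Proof.
move=> px xy; have -> : y = x - z * n by rewrite mulrC -xy; ring.
by apply: maxB => //; apply: maxM.
Qed.

(* A power of the product of all residues outside [p]; it cuts out the local
   factor of [A / n] at [p]. *)
Lemma local_idempotent : exists e, [/\ ~ p e,
  exists z, e * e - e = n * z
  & forall x, ~ p x -> exists y z, x * y - e = n * z].
Proof.
have [f [rep [fP repK]]] := degA_residues dnP.
pose c := \prod_(z | ~~ `[< p (rep z) >]) rep z.
have pc : ~ p c.
  rewrite /c; elim/big_ind: _ => [|x y|z /asboolP //]; first exact: max1.
  exact: max_prime.
have [i [j [ltij [w ijw]]]] := power_period c.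
pose t := (j - i)%N; have t_gt0 : (0 < t)%N by rewrite subn_gt0.
have period m k : (i <= m)%N -> exists z, c ^+ (m + t * k) - c ^+ m = n * z.
  move=> im; elim: k => [|k [z zP]]; first by exists 0; rewrite muln0 addn0 subrr mulr0.
  exists (z - c ^+ (m - i + t * k) * w).
  have e1 : c ^+ (m + t * k) = c ^+ (m - i + t * k) * c ^+ i.
    by rewrite -exprD; congr (c ^+ _); lia.
  have e2 : c ^+ (m + t * k.+1) = c ^+ (m - i + t * k) * c ^+ j.
    by rewrite -exprD mulnS; congr (c ^+ _); rewrite /t; lia.
  have -> : n * (z - c ^+ (m - i + t * k) * w) =
      n * z - c ^+ (m - i + t * k) * (n * w) by ring.
  by rewrite -ijw -zP mulrBr -e1 -e2; ring.
(* A multiple of the period [t] that is at least the preperiod [i], so [c ^+ m] is idempotent modulo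
   [n]. *)
pose m := (t * i.+1)%N.
have im : (i <= m)%N by rewrite /m; nia.
exists (c ^+ m); split; first exact: max_primeX.
  by have [z] := period m i.+1 im; rewrite -/m exprD => zP; exists z.
move=> x px; have [z zP] : exists z, x - rep (f x) = n * z by apply/fP; rewrite repK.
have prx : ~ p (rep (f x)).
  move=> pr; apply: px; apply: (max_dvd (z := - z) pr).
  by rewrite mulrN -zP opprB.
have [c' c'P] : exists c', c = rep (f x) * c'.
  by eexists; rewrite /c (bigD1 (f x)) //; apply/asboolP.
exists (c' * c ^+ m.-1), (z * (c' * c ^+ m.-1)).
have -> : c ^+ m = rep (f x) * (c' * c ^+ m.-1).
  by rewrite mulrA -c'P -exprS prednK // /m muln_gt0 t_gt0.
by rewrite [RHS]mulrA -zP; ring.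
Qed.

(** Take a non-zero class [b] in the local factor [e A / n] with the fewest multiples. If [u * b] is
    non-zero for some [u] in [p], it has the same multiples, so [(1 - v * u) * b] vanishes for some
    [v], although [1 - v * u] is invertible on that factor. *)
Lemma associated_element : exists b, (forall z, b <> n * z) /\
  forall u, p u -> exists z, u * b = n * z.
Proof.
have [f [rep [fP repK]]] := degA_residues dnP.
have [e [pe [ze eP] einv]] := local_idempotent.
pose mults b := [set z | `[< exists u, f (u * b) = z >]]%SET.
pose cand b := (exists z, e * b - b = n * z) /\ (forall z, b <> n * z).
have ex : exists k, `[< exists2 b, cand b & #|mults b| = k >].
  exists #|mults e|; apply/asboolP; exists e => //; split; first by exists ze.
  by move=> z ez; apply: pe; rewrite ez mulrC; apply: maxM.
have [k /asboolP[b [[zb bP] nb] bk] kmin] := ex_minnP ex.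
exists b; split=> // u pu; apply: contrapT => no.
have ub : cand (u * b).
  split; last by move=> z ubz; apply: no; exists z.
  by exists (u * zb); rewrite [RHS]mulrCA -bP; ring.
have sub : mults (u * b) \subset mults b.
  apply/fintype.subsetP => z; rewrite !finset.inE => /asboolP[v <-]; apply/asboolP.
  by exists (v * u); rewrite mulrA.
have eqm : mults (u * b) = mults b.
  apply/eqP; rewrite eqEcard sub bk kmin //.
  by apply/asboolP; exists (u * b).
have : f b \in mults (u * b).
  by rewrite eqm finset.inE; apply/asboolP; exists 1; rewrite mul1r.
rewrite finset.inE => /asboolP[v /fP[z vz]].
have [|y [w yw]] := einv (1 - v * u).
  move=> p1; apply: (max1 pP); rewrite -[1](subrK (v * u)).
  by apply: maxD => //; apply: maxM.
apply: (nb (- (zb + w * b + z * y))).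
have -> : n * - (zb + w * b + z * y) = - (n * zb) - n * w * b - n * z * y by ring.
by rewrite -yw -vz -bP; ring.
Qed.

(* With [b] as in [associated_element], [y = b / n] maps [p] into [A].  If it
   mapped [p] into itself, then [y] would lie in every valuation ring containing
   [A], as [p] is finitely generated; so [y * pi] is outside [p] for some [pi]. *)
Lemma uniformizer : exists2 pi, p pi &
  forall u, p u -> exists x v, ~ p x /\ x * u = pi * v.
Proof.
have n0 : n != 0 by case: dnP.
have [f [rep [fP repK]]] := degA_residues dnP.
have [b [nb bP]] := associated_element.
have [[pi [ppi [c [pc pibc]]]]|no] :=
    pselect (exists pi, p pi /\ exists c, ~ p c /\ pi * b = n * c).
  exists pi => // u pu; have [v uv] := bP _ pu; exists c, v; split=> //.
  by apply: (coef_ringI n0); rewrite mulrA -pibc [RHS]mulrCA -uv; ring.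
exfalso.
have valn0 : val n != 0 by rewrite -(rmorph0 (val : A -> F)) (inj_eq val_inj).
have bn_reg : ~~ (val b / val n \in regular_outside Oinf).
  apply/negP => reg; apply: (nb (CoefRing reg)); apply: val_inj.
  by rewrite rmorphM /= mulrC divfK.
have [O [pO OO nO]] : exists O, [/\ place O, O <> Oinf & ~ O (val b / val n)].
  apply: contrapT => no'; move/negP: bn_reg; apply; apply/asboolP => O pO OO.
  by apply: contrapT => nO; apply: no'; exists O.
(* Together with [n] these representatives generate [p], so the element [g] of least valuation below
   divides all of [p] in [O]. *)
pose s := [seq val (rep z) | z <- enum {ffun 'I_dn -> K} & `[< p (rep z) >] && (rep z != 0)].
have [|g gs gP] := @place_dominant O s (val n) pO.
  rewrite /= valn0; apply/allP => _ /mapP[z + ->].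
  rewrite mem_filter => /andP[/andP[_ z0] _].
  by rewrite -(rmorph0 (val : A -> F)) (inj_eq val_inj).
have [g' pg' gg'] : exists2 g', p g' & g = val g'.
  move: gs; rewrite inE => /orP[/eqP ->|]; first by exists n.
  move=> /mapP[z]; rewrite mem_filter => /andP[/andP[/asboolP pz _] _] ->.
  by exists (rep z).
have g0 : g != 0.
  move: gs; rewrite inE => /orP[/eqP ->//|].
  move=> /mapP[z]; rewrite mem_filter => /andP[/andP[_ z0] _] ->.
  by rewrite -(rmorph0 (val : A -> F)) (inj_eq val_inj).
have [c gbc] := bP _ pg'.
have pc : p c by apply: contrapT => pc; apply: no; exists g'; split=> //; exists c.
have [w cw] : exists w, c - rep (f c) = n * w by apply/fP; rewrite repK.
have [O1 OB OM] := place_ring pO.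
(* From [g * b = n * c] one gets [b / n = c / g], and [c] is a representative in [p] plus a multiple
   of [n], both divisible by [g] in [O]. *)
apply: nO.
have -> : val b / val n = val (rep (f c)) / g - (- val w) * (val n / g).
  have /(congr1 val) := gbc; have /(congr1 val) := cw.
  rewrite rmorphB !rmorphM /= -gg' => cw' gbc'.
  have cE : val c = val (rep (f c)) + val n * val w by rewrite -cw' addrC subrK.
  have -> : val b / val n = val c / g.
    by apply/eqP; rewrite eqr_div // [val b * _]mulrC gbc' mulrC.
  by rewrite cE mulrDl mulNr opprK; congr (_ + _); rewrite [RHS]mulrCA mulrA.
apply: OB.
  have [->|z0] := eqVneq (rep (f c)) 0.
    by rewrite rmorph0 mul0r -(rmorph0 (val : A -> F)); apply: regular_place.
  apply: gP; rewrite inE; apply/orP; right; apply/mapP; exists (f c) => //.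
  rewrite mem_filter z0 mem_enum andbT; apply/andP; split=> //; apply/asboolP.
  exact: max_dvd pc cw.
apply: OM.
  by rewrite -rmorphN; apply: regular_place.
by apply: gP; rewrite mem_head.
Qed.

End OneIdeal.
End MaximalIdeals.

(** * Lower bounds for tau-degrees from the torsion at a maximal ideal *)

Section TorsionBound.
Variables (K : finFieldType) (F : fieldType) (Oinf : set F).
Notation A := (coef_ring Oinf).
Variable iota : {rmorphism K -> A}.
Notation q := #|K|.
Implicit Types (a b u v x y : A).
Variables (n : A) (dn : nat) (p : set A).
Hypotheses (dnP : degA_is iota n dn) (pP : maximal_ideal p) (pn : p n).

(** Combinations of a family that is [K]-independent modulo [p] are distinct modulo [n], which
    bounds its length by [dn]; a family of maximal length spans [A / p]. *)
Lemma maximal_residues : exists h (f : A -> {ffun 'I_h -> K})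
    (rep : {ffun 'I_h -> K} -> A),
  (forall x y, f x = f y <-> p (x - y)) /\ cancel rep f.
Proof.
have [f [rep [fP repK]]] := degA_residues dnP.
(* Indexing by [nat] lets a family be lengthened without changing its type; [ofn] extends a
   coefficient vector by zero. *)
pose comb h (e : nat -> A) (c : nat -> K) := \sum_(i < h) iota (c i) * e i.
pose indep h (e : nat -> A) :=
  forall c, p (comb h e c) -> forall i, (i < h)%N -> c i = 0.
pose ofn h (c : {ffun 'I_h -> K}) i := if insub i is Some i' then c i' else 0.
have combB h e c c' : comb h e c - comb h e c' = comb h e (fun i => c i - c' i).
  by rewrite -sumrB; apply: eq_bigr => i _; rewrite rmorphB mulrBl.
have ofnE h (c : {ffun 'I_h -> K}) (i : 'I_h) : ofn h c i = c i.
  by rewrite /ofn valK.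
have indep_inj h e (c c' : {ffun 'I_h -> K}) : indep h e ->
    p (comb h e (ofn h c) - comb h e (ofn h c')) -> c = c'.
  move=> he; rewrite combB => /he e0; apply/ffunP => i; apply/eqP.
  by rewrite -subr_eq0 -!ofnE e0.
have bound h e : indep h e -> (h <= dn)%N.
  move=> he; rewrite -(leq_exp2l _ _ (finNzRing_gt1 K)).
  have /leq_card : injective (fun c : {ffun 'I_h -> K} => f (comb h e (ofn h c))).
    move=> c c' /fP[z zP]; apply: (indep_inj _ _ _ _ he).
    by rewrite zP mulrC; apply: (maxM pP).
  by rewrite !card_ffun !card_ord.
have ex0 : exists h, `[< exists e, indep h e >].
  by exists 0%N; apply/asboolP; exists (fun=> 0).
have bnd h : `[< exists e, indep h e >] -> (h <= dn)%N.
  by move=> /asboolP[e /bound].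
have [h /asboolP[e he] hmax] := ex_maxnP ex0 bnd.
have span x : exists c : {ffun 'I_h -> K}, p (x - comb h e (ofn h c)).
  apply: contrapT => no.
  suff : (h.+1 <= h)%N by rewrite ltnn.
  apply: hmax; apply/asboolP; exists (fun i => if i == h then x else e i) => c.
  rewrite /comb big_ord_recr /= eqxx.
  under eq_bigr => i _ do rewrite (ltn_eqF (ltn_ord i)).
  rewrite -/(comb h e c) => pc.
  have ch : c h = 0.
    apply: contrapT => /eqP ch; apply: no.
    exists [ffun i : 'I_h => - (c h)^-1 * c i].
    have -> : x - comb h e (ofn h [ffun i : 'I_h => - (c h)^-1 * c i]) =
        iota (c h)^-1 * (comb h e c + iota (c h) * x).
      rewrite mulrDr mulrA -rmorphM mulVf // rmorph1 mul1r addrC; congr (_ + _).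
      rewrite /comb -sumrN mulr_sumr; apply: eq_bigr => i _.
      by rewrite ofnE ffunE mulNr rmorphN mulNr opprK rmorphM mulrA.
    exact: (maxM pP).
  move: pc; rewrite ch rmorph0 mul0r addr0 => /he c0 i.
  by rewrite ltnS leq_eqVlt => /orP[/eqP ->//|/c0].
have [g gP] := choice span.
exists h, g, (fun c => comb h e (ofn h c)); split=> [x y|c]; last first.
  by apply: (indep_inj _ _ _ _ he); rewrite -opprB -sub0r;
     apply: (maxB pP) => //; apply: max0 pP pn.
split=> [gxy|pxy].
  have -> : x - y = (x - comb h e (ofn h (g x))) - (y - comb h e (ofn h (g y))).
    by rewrite gxy; ring.
  exact: (maxB pP).
apply: (indep_inj _ _ _ _ he).
have -> : comb h e (ofn h (g x)) - comb h e (ofn h (g y)) =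
    (x - y) - ((x - comb h e (ofn h (g x))) - (y - comb h e (ofn h (g y)))) by ring.
by do 2!apply: (maxB pP) => //.
Qed.

Variable pi : A.
Hypothesis (piP : forall u, p u -> exists x v, ~ p x /\ x * u = pi * v).

(* The intersection of [A] with [pi ^ k A_p]. *)
Definition symbolic_power k : set A :=
  [set y | exists x v, ~ p x /\ x * y = pi ^+ k * v].

(** If [x * z = pi ^+ k * y] with [x] outside [p], send [z] to the residue of [y * inv x], where
    [inv] inverts modulo [p]. Equal residues force [x2 * y1 - x1 * y2] into [p], which yields one
    more factor [pi] up to an element outside [p]. *)
Lemma symbolic_power_index_le h (f : A -> {ffun 'I_h -> K}) k :
  (forall x y, f x = f y <-> p (x - y)) ->
  index_le (symbolic_power k) (q ^ (k * h)).
Proof.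
move=> fP; elim: k => [|k IH].
  exists unit, (fun=> tt); rewrite card_unit; split=> // x y _.
  by exists 1, (x - y); split; [exact: max1 pP|rewrite expr0].
rewrite mulSn addnC expnD; apply: index_le_chain IH _.
have /choice[inv invP] : forall x, exists y, ~ p x -> p (1 - x * y).
  move=> x; have [px|px] := pselect (p x); first by exists 0.
  by have [y] := max_inv pP px; exists y.
pose quo z : A := if pselect (symbolic_power k z) is left ex
  then let x := projT1 (cid ex) in projT1 (cid (projT2 (cid ex))) * inv x else 0.
exists {ffun 'I_h -> K}, (f \o quo); rewrite card_ffun card_ord; split=> //.
move=> z1 z2 Iz1 Iz2 /fP; rewrite /quo.
case: pselect => // ?; case: cid => x1 /= ex1; case: cid => y1 [px1 xz1] /=.
case: pselect => // ?; case: cid => x2 /= ex2; case: cid => y2 [px2 xz2] /= pyy.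
have pu : p (x2 * y1 - x1 * y2).
  have -> : x2 * y1 - x1 * y2 = x1 * x2 * (y1 * inv x1 - y2 * inv x2)
      + x2 * y1 * (1 - x1 * inv x1) - x1 * y2 * (1 - x2 * inv x2) by ring.
  apply: (maxB pP); last exact/(maxM pP)/invP.
  by apply: (maxD pP pn); apply: (maxM pP) => //; apply: invP.
have [x3 [v [px3 xv]]] := piP pu.
exists (x3 * (x1 * x2)), v; split.
  by do 2!apply: (max_prime pP pn) => //.
have -> : x3 * (x1 * x2) * (z1 - z2) = x3 * (x2 * (x1 * z1) - x1 * (x2 * z2)) by ring.
rewrite xz1 xz2 exprSr -mulrA -xv; ring.
Qed.

Variables (R : comUnitAlgType F) (phi : A -> {poly R}).
Hypothesis phiP : tau_hom iota phi.
Hypothesis phi_lead : forall a, a != 0 -> exists m, unit_lead K phi a m.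
(** In the application [rs] lists the values of [inv_map rho] on [W[p]]; [rs_div] records that
    elements outside [p] act surjectively there. *)
Variables (rs : seq R) (d : nat).
Hypotheses (rs_uniq : uniq_roots rs)
  (rs_size : forall j, (j < d)%N -> (q ^ j < size rs)%N)
  (rs_pi : forall t, t \in rs -> (phi pi).[t] = 0)
  (rs_div : forall x, ~ p x -> forall t, t \in rs -> exists2 t', t' \in rs & t = (phi x).[t']).

Let q_gt1 : (1 < q)%N := finNzRing_gt1 K.
Let phi_tau a : tau_poly K (phi a). Proof. by case: phiP. Qed.
Let phiM a b : phi (a * b) = phi a \Po phi b. Proof. by case: phiP. Qed.

Lemma short_tau_poly_eq0 (s : nat -> R) :
  (forall t, t \in rs -> (\sum_(j < d) s j *: 'X^(q ^ j)).[t] = 0) ->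
  forall j, (j < d)%N -> s j = 0.
Proof.
move=> s0; suff sum0 : \sum_(j < d) s j *: 'X^(q ^ j) = 0.
  move=> j jd; have := congr1 (fun P : {poly R} => P`_(q ^ j)) sum0.
  rewrite coef0 coef_sum (bigD1 (Ordinal jd)) //= coefZ coefXn eqxx mulr1 big1 ?addr0 //.
  move=> i ij; rewrite coefZ coefXn eqn_exp2l // eq_sym.
  by rewrite -(inj_eq val_inj) /= in ij; rewrite (negbTE ij) mulr0.
apply/eqP/negPn/negP => sum0.
have /(max_ring_poly_roots sum0)/(_ rs_uniq) : all (root (\sum_(j < d) s j *: 'X^(q ^ j))) rs.
  by apply/allP => t /s0 /eqP.
rewrite ltnNge => /negP; apply; apply: (leq_trans (size_sum _ _ _)).
apply/bigmax_leqP => j _; apply: leq_trans (size_scale_leq _ _) _.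
by rewrite size_polyXn rs_size.
Qed.

Let pi0 : pi != 0.
Proof.
apply/eqP => pi0; have [x [v [px]]] := piP pn; have n0 : n != 0 by case: dnP.
rewrite pi0 mul0r => /eqP; rewrite coef_ring_mul_eq0 (negbTE n0) orbF => /eqP x0.
by apply: px; rewrite x0; apply: max0 pP pn.
Qed.

Let phi_lreg a (g : {poly R}) : a != 0 -> g \Po phi a = 0 -> g = 0.
Proof.
move=> /phi_lead[m am]; apply: comp_poly_lreg am.2 _.
by have := unit_lead_size_gt1 am.
Qed.

(* Dividing by [phi pi] on the right peels off one [s i] at a time: the torsion
   points in [rs] are killed by [phi pi], while [phi x] permutes them. *)
Lemma divided_tau_polys_eq0 k x (s : nat -> nat -> R) (g : {poly R}) :
  ~ p x -> g.[0] = 0 ->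
  \sum_(i < k) ((\sum_(j < d) s i j *: 'X^(q ^ j)) \Po phi (pi ^+ i * x))
    + (g \Po phi (pi ^+ k)) = 0 ->
  (forall i j, (i < k)%N -> (j < d)%N -> s i j = 0) /\ g = 0.
Proof.
move=> px g0; elim: k s => [|k IH] s.
  rewrite big_ord0 add0r => /(phi_lreg (coef_ring_expf_neq0 _ pi0)).
  by [].
rewrite big_ord_recl expr0 mul1r /=.
set S0 := \sum_(j < d) _; pose S i := \sum_(j < d) s i j *: 'X^(q ^ j).
pose T := \sum_(i < k) (S i.+1 \Po phi (pi ^+ i * x)) + (g \Po phi (pi ^+ k)).
have -> : S0 \Po phi x + \sum_(i < k) (S (bump 0 i) \Po phi (pi ^+ bump 0 i * x))
    + (g \Po phi (pi ^+ k.+1)) = (S0 \Po phi x) + (T \Po phi pi).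
  rewrite -addrA; congr (_ + _); rewrite /T comp_polyD raddf_sum; congr (_ + _).
    apply: eq_bigr => i _; rewrite /= -comp_polyA -phiM.
    by rewrite /bump add1n exprSr -!mulrA [pi * x]mulrC.
  by rewrite -comp_polyA -phiM exprSr.
have S_0 i : (S i).[0] = 0.
  apply: (tau_poly_horner0 (K := K)); apply: tau_poly_sum => j.
  exact/tau_polyZ/tau_polyXq.
have phi_0 a : (phi a).[0] = 0 by apply: (tau_poly_horner0 (K := K)).
have T0 : T.[0] = 0.
  rewrite /T hornerD horner_sum horner_comp phi_0 g0 addr0 big1 // => i _.
  by rewrite horner_comp phi_0.
move=> ST; have s0 : forall j, (j < d)%N -> s 0 j = 0.
  apply: short_tau_poly_eq0 => t /(rs_div px)[t' t's ->].
  have /(congr1 (horner^~ t')) := ST.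
  by rewrite hornerD !horner_comp rs_pi // T0 addr0 horner0.
have : T \Po phi pi = 0.
  rewrite -ST -[LHS]add0r; congr (_ + _); rewrite /S0 big1 ?comp_poly0 //.
  by move=> j _; rewrite s0 ?scale0r.
move=> /(phi_lreg pi0) /(IH (fun i => s i.+1))[sS ->].
split=> // -[|i] j; first by move=> _; apply: s0.
by rewrite ltnS => ik jd; apply: sS.
Qed.

(** If [k * d] exceeded the tau-degree of [a], the [k * d] polynomials [tau ^ j phi (pi ^+ i)] and
    the multiples [tau ^ l phi a] would outnumber their coefficients, hence be dependent. Composing
    with [phi x], where [x * a = pi ^+ k * y], gives a relation that [divided_tau_polys_eq0]
    excludes. *)
Lemma torsion_rank_le k a m : symbolic_power k a -> a != 0 ->
  tau_deg_le K phi a m -> (k * d <= m)%N.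
Proof.
move=> [x [y [px xy]]] a0 adm; have [ma am] := phi_lead a0.
apply: leq_trans (unit_lead_deg_le am adm); rewrite leqNgt; apply/negP => lt.
have [mp mpP] := tau_deg_le_fin_bounded K phi (fun i : 'I_k => pi ^+ i).
(* Every row has tau-degree below [M], hence [M] coefficients, while there are
   [k * d + (M - ma) > M] rows. *)
pose M := (maxn ma (mp + d)).+1.
pose row (i : 'I_k * 'I_d + 'I_(M - ma)) : {poly R} :=
  match i with
  | inl (i, j) => phi (pi ^+ i) ^+ (q ^ j)
  | inr l => phi a ^+ (q ^ l)
  end.
have row_tau i : tau_poly K (row i).
  by case: i => [[i j]|l]; apply: (tau_poly_exprq (in_alg R \o val \o iota)).
have row_size i : (size (row i) <= (q ^ M.-1).+1)%N.
  have szX (P : {poly R}) m' j : (size P <= (q ^ m').+1)%N -> (m' + j <= M.-1)%N ->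
      (size (P ^+ (q ^ j))%R <= (q ^ M.-1).+1)%N.
    move=> sP le; apply: leq_trans (size_poly_exp_leq _ _) _; rewrite ltnS.
    apply: leq_trans (leq_mul (_ : (size P).-1 <= q ^ m')%N (leqnn _)) _.
      by rewrite -subn1 leq_subLR add1n.
    by rewrite -expnD leq_exp2l.
  case: i => [[i j]|l] /=.
    by apply: szX (mpP i) _; have := ltn_ord j; rewrite /M /=; lia.
  apply: szX (unit_lead_tau_deg_le am) _.
  by have := ltn_ord l; rewrite /M /=; lia.
have [|r [i0 ri0] rP] := linear_dependence (I := ('I_k * 'I_d + 'I_(M - ma))%type)
    (fun i (l : 'I_M) => (row i)`_(q ^ l)).
  rewrite card_sum card_prod !card_ord.
  have : (ma <= M)%N by rewrite /M leqW // leq_maxl.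
  by lia.
have Z0 : \sum_i r i *: row i = 0.
  rewrite [LHS](@tau_polyE K _ _ _ M.-1).
  - rewrite big1 // => l _; rewrite coef_sum.
    under eq_bigr do rewrite coefZ.
    by rewrite rP scale0r.
  - by apply: tau_poly_sum => i; apply: tau_polyZ.
  - apply: leq_trans (size_sum _ _ _) _; apply/bigmax_leqP => i _.
    exact: leq_trans (size_scale_leq _ _) (row_size i).
pose s (i j : nat) := if insub i is Some i' then
  (if insub j is Some j' then r (inl (i', j')) else 0) else 0.
pose C := \sum_(l < M - ma) r (inr l) *: 'X^(q ^ l).
have Xn_comp (P : {poly R}) l : 'X^l \Po P = P ^+ l by rewrite comp_Xn_poly.
have [s0 C0] : (forall i j, (i < k)%N -> (j < d)%N -> s i j = 0) /\ C \Po phi y = 0.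
  apply: (@divided_tau_polys_eq0 k x s) => //.
    rewrite horner_comp (tau_poly_horner0 (@phi_tau y)).
    apply: (tau_poly_horner0 (K := K)); apply: tau_poly_sum => l.
    exact/tau_polyZ/tau_polyXq.
  (* [phi y \Po phi (pi ^+ k)] equals [phi a \Po phi x], so the whole left side is
     [\sum_i r i *: row i] composed with [phi x]. *)
  rewrite -comp_polyA -phiM [y * _]mulrC -xy mulrC phiM comp_polyA.
  under eq_bigr => i _ do rewrite phiM comp_polyA.
  rewrite -raddf_sum -comp_polyD.
  transitivity ((\sum_i r i *: row i) \Po phi x); last by rewrite Z0 comp_poly0.
  congr (_ \Po _); rewrite big_sumType /=; congr (_ + _).
    rewrite [RHS](eq_bigr (fun ij => r (inl (ij.1, ij.2)) *: row (inl (ij.1, ij.2)))).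
      rewrite -(pair_bigA _ (fun i j => r (inl (i, j)) *: row (inl (i, j)))) /=.
      apply: eq_bigr => i _; rewrite raddf_sum; apply: eq_bigr => j _.
      by rewrite /= comp_polyZ Xn_comp /s !valK.
    by case.
  rewrite /C raddf_sum; apply: eq_bigr => l _.
  by rewrite /= comp_polyZ Xn_comp.
have {}C0 : C = 0.
  apply: phi_lreg C0; apply/eqP => y0; move: xy; rewrite y0 mulr0 => /eqP.
  rewrite coef_ring_mul_eq0 (negbTE a0) orbF => /eqP x0; apply: px.
  by rewrite x0; apply: max0 pP pn.
move/eqP: ri0; apply; case: i0 => [[i j]|l].
  by have := s0 i j (ltn_ord i) (ltn_ord j); rewrite /s !valK.
have := congr1 (fun P : {poly R} => P`_(q ^ l)) C0.
rewrite coef0 coef_sum (bigD1 l) //= coefZ coefXn eqxx mulr1 big1 ?addr0 //.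
move=> i il; rewrite coefZ coefXn eqn_exp2l // eq_sym.
by rewrite -(inj_eq val_inj) /= in il; rewrite (negbTE il) mulr0.
Qed.

End TorsionBound.

(** * Generators of finite modules *)

Section FiniteSets.
Local Notation card S := #|` fset_set S|.

Lemma fset_setP (T : choiceType) (S : set T) x : finite_set S ->
  reflect (S x) (x \in fset_set S).
Proof.
move=> fS; rewrite in_fset_set //.
by apply: (iffP idP) => [/set_mem|/mem_set].
Qed.

Lemma card_cover2 (T1 T2 T : choiceType) (S1 : set T1) (S2 : set T2) (S : set T)
    (f : T1 -> T2 -> T) : finite_set S1 -> finite_set S2 -> finite_set S ->
  (forall x, S x -> exists x1 x2, [/\ S1 x1, S2 x2 & x = f x1 x2]) ->
  (card S <= card S1 * card S2)%N.
Proof.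
move=> fS1 fS2 fS cover; rewrite -(size_allpairs f); apply: uniq_leq_size => // x.
move=> /(fset_setP _ fS)/cover[x1 [x2 [S1x1 S2x2 ->]]].
by apply: allpairs_f; apply/fset_setP.
Qed.

Lemma card_inj2 (T1 T2 T : choiceType) (S1 : set T1) (S2 : set T2) (S : set T)
    (f : T1 -> T2 -> T) : finite_set S1 -> finite_set S2 -> finite_set S ->
  (forall x1 x2, S1 x1 -> S2 x2 -> S (f x1 x2)) ->
  (forall x1 x2 y1 y2, S1 x1 -> S2 x2 -> S1 y1 -> S2 y2 ->
     f x1 x2 = f y1 y2 -> x1 = y1 /\ x2 = y2) ->
  (card S1 * card S2 <= card S)%N.
Proof.
move=> fS1 fS2 fS fST finj; rewrite -(size_allpairs f); apply: uniq_leq_size.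
  apply: allpairs_uniq => // -[x1 x2] [y1 y2] /allpairsP[[a b] /= [a1 b2 [-> ->]]].
  move=> /allpairsP[[a' b'] /= [a1' b2' [-> ->]]] /= feq.
  by have [|||| -> ->] // := finj _ _ _ _ _ _ _ _ feq; apply/fset_setP.
move=> _ /allpairsP[[a b] /= [/(fset_setP _ fS1) Sa /(fset_setP _ fS2) Sb ->]].
by apply/(fset_setP _ fS); apply: fST.
Qed.

Lemma card_setS (T : choiceType) (S S' : set T) : finite_set S' -> S `<=` S' ->
  (card S <= card S')%N.
Proof.
move=> fS' SS'; have fS := sub_finite_set SS' fS'; apply: fsubset_leq_card.
by apply/fsubsetP => x /(fset_setP _ fS) /SS' S'x; apply/fset_setP.
Qed.

Lemma card_set_proper (T : choiceType) (S S' : set T) x : finite_set S' -> S `<=` S' ->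
  S' x -> ~ S x -> (card S < card S')%N.
Proof.
move=> fS' SS' S'x Sx; apply: fproper_ltn_card.
have fS := sub_finite_set SS' fS'; rewrite fproperE; apply/andP; split.
  by apply/fsubsetP => y /(fset_setP _ fS) /SS' S'y; apply/fset_setP.
apply/negP => /fsubsetP/(_ x); rewrite (introT (fset_setP _ fS') S'x).
by move=> /(_ isT)/(fset_setP _ fS).
Qed.

Lemma card_fin_inj (T : choiceType) (Y : finType) (S : set T) (f : T -> Y) :
  finite_set S -> (forall x y, S x -> S y -> f x = f y -> x = y) ->
  (card S <= #|Y|)%N.
Proof.
move=> fS finj; rewrite -(size_map f) cardE.
apply: uniq_leq_size => [|y _]; last by rewrite mem_enum.
rewrite map_inj_in_uniq // => x y /(fset_setP _ fS) Sx /(fset_setP _ fS) Sy.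
exact: finj.
Qed.

Lemma card_surj_inj (T : choiceType) (Y : finType) (S : set T) (f : Y -> T) :
  finite_set S -> (forall x, S x -> exists y, x = f y) -> card S = #|Y| ->
  injective f.
Proof.
move=> fS surj cS; apply/injectiveP; rewrite /injectiveb /dinjectiveb.
apply: (@leq_size_uniq _ (fset_set S)) => // [x /(fset_setP _ fS)/surj[y ->]|].
  by apply/mapP; exists y; rewrite ?mem_enum.
by rewrite size_map -cardE cS.
Qed.

End FiniteSets.

Section FiniteModules.
Local Notation card S := #|` fset_set S|.
Variables (K : finFieldType) (F : fieldType) (Oinf : set F).
Notation A := (coef_ring Oinf).
Variable iota : {rmorphism K -> A}.
Notation q := #|K|.
Variables (n : A) (dn : nat).
Hypothesis dnP : degA_is iota n dn.
Variables (M : lmodType A) (W : set M).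
Hypotheses (Wfin : finite_set W) (W0 : W 0)
  (WL : forall (a : A) v w, W v -> W w -> W (a *: v + w))
  (Wn : forall w, W w -> n *: w = 0).

Definition span d (u : nat -> M) : set M :=
  [set w | exists c : nat -> A, w = \sum_(i < d) c i *: u i].

Definition torsion (p : set A) : set M :=
  [set w | W w /\ forall a, p a -> a *: w = 0].

Lemma spanL d u a v w : span d u v -> span d u w -> span d u (a *: v + w).
Proof.
move=> [c ->] [c' ->]; exists (fun i => a * c i + c' i).
rewrite scaler_sumr -big_split; apply: eq_bigr => i _.
by rewrite scalerDl scalerA.
Qed.

Lemma span0 d u : span d u 0.
Proof. by exists (fun=> 0); rewrite big1 // => i _; rewrite scale0r. Qed.

Lemma span_sub d u (V : set M) : V 0 ->
  (forall (a : A) v w, V v -> V w -> V (a *: v + w)) ->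
  (forall i, (i < d)%N -> V (u i)) -> span d u `<=` V.
Proof.
move=> V0 VL Vu _ [c ->]; elim: d Vu => [|d IH] Vu; first by rewrite big_ord0.
rewrite big_ord_recr /= addrC; apply: VL; first exact: Vu.
by apply: IH => i lt; apply: Vu; rewrite ltnW.
Qed.

(** * The part of a finite module at one maximal ideal *)

Section Local.
Variable p : set A.
Hypotheses (pP : maximal_ideal p) (pn : p n).
Variables (e pi : A).
Hypotheses (ee : exists z, e * e - e = n * z)
  (einv : forall x, ~ p x -> exists y z, x * y - e = n * z).
Hypotheses (ppi : p pi)
  (piP : forall u, p u -> exists x v, ~ p x /\ x * u = pi * v).
Variables (h d : nat) (f : A -> {ffun 'I_h -> K}) (rep : {ffun 'I_h -> K} -> A).
Hypotheses (fP : forall x y, f x = f y <-> p (x - y)) (repK : cancel rep f).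

Let X : set M := [set w | W w /\ e *: w = w].
Let piX : set M := [set pi *: x | x in X].
Let U k u : set M := [set w | exists2 v, span k u v & exists2 x, X x & w = v + pi *: x].

Hypothesis small_torsion : (card (torsion p) < (q ^ h) ^ d.+1)%N.

Lemma local_partW w : W w -> X (e *: w).
Proof.
move=> Ww; split; first by rewrite -[e *: w]addr0; apply: WL.
have [z ez] := ee; apply/eqP; rewrite scalerA -subr_eq0 -scalerBl ez mulrC -scalerA.
by rewrite Wn // scaler0.
Qed.

Lemma local_partL a v w : X v -> X w -> X (a *: v + w).
Proof.
move=> [Wv ev] [Ww ew]; split; first exact: WL.
by rewrite scalerDr ew scalerA mulrC -scalerA ev.
Qed.

Lemma local_part0 : X 0. Proof. by split=> //; rewrite scaler0. Qed.

Let XZ a v : X v -> X (a *: v).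
Proof. by move=> Xv; rewrite -[a *: v]addr0; apply: local_partL => //; apply: local_part0. Qed.

Lemma local_part_inv x w : ~ p x -> X w -> exists y, y *: (x *: w) = w.
Proof.
move=> /einv[y [z yz]] [Ww ew]; exists y; rewrite scalerA mulrC -[RHS]ew; apply/eqP.
by rewrite -subr_eq0 -scalerBl yz mulrC -scalerA Wn // scaler0.
Qed.

Let Xfin : finite_set X. Proof. by apply: sub_finite_set Wfin => w []. Qed.
Let piXfin : finite_set piX. Proof. exact: finite_image. Qed.
Let Ufin k u : (forall i, X (u i)) -> finite_set (U k u).
Proof.
move=> Xu; apply: sub_finite_set Xfin => _ [v sv [x Xx ->]].
rewrite addrC; apply: local_partL => //.
by apply: (span_sub local_part0 local_partL) sv.
Qed.

(** What [pi] kills in [X] is killed by all of [p], since [x * u = pi * v] with [x] acting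
    invertibly on [X]. So the fibers of multiplication by [pi] are no larger than [torsion p]. *)
Lemma card_local_part_le : (card X <= card (torsion p) * card piX)%N.
Proof.
have tfin : finite_set (torsion p) by apply: sub_finite_set Wfin => w [].
have /choice[s sP] : forall y, exists x, piX y -> X x /\ pi *: x = y.
  move=> y; have [[x Xx <-]|no] := pselect (piX y); first by exists x.
  by exists 0.
apply: (@card_cover2 _ _ _ _ _ _ (fun k y => k + s y)) => // x Xx.
have piXx : piX (pi *: x) by exists x.
have [Xs ps] := sP _ piXx.
exists (x - s (pi *: x)), (pi *: x); split=> //; last by rewrite subrK.
have Xk : X (x - s (pi *: x)) by rewrite addrC -scaleN1r; apply: local_partL.
split=> [|u /piP[y [v [py yu]]]]; first by case: Xk.
have [y' <-] := local_part_inv py (XZ u Xk).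
by rewrite (scalerA y u) yu mulrC -scalerA scalerBr ps subrr !scaler0.
Qed.

(** For [w] in [X] but not in [U k u], the elements [rep c *: w] lie in different classes modulo
    [U k u]: a difference of representatives is outside [p], hence invertible on [X]. *)
Lemma local_generation_step k u : (forall i, X (u i)) -> ~ X `<=` U k u ->
  exists2 u', forall i, X (u' i) & (q ^ h * card (U k u) <= card (U k.+1 u'))%N.
Proof.
move=> Xu XU; have [w [Xw Uw]] : exists w, X w /\ ~ U k u w.
  by apply: contrapT => no; apply: XU => w Xw; apply: contrapT => Uw; apply: no; exists w.
have UL a v y : U k u v -> U k u y -> U k u (a *: v + y).
  move=> [v1 sv1 [x1 Xx1 ->]] [v2 sv2 [x2 Xx2 ->]].
  exists (a *: v1 + v2); first exact: spanL.
  exists (a *: x1 + x2); first exact: local_partL.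
  by rewrite !scalerDr !scalerA [a * pi]mulrC addrACA.
exists (fun i => if i == k then w else u i); first by move=> i; case: eqP.
set u' := fun i => _; have Xu' i : X (u' i) by rewrite /u'; case: eqP.
have -> : (q ^ h)%N = card [set: {ffun 'I_h -> K}].
  rewrite -[in LHS](card_ord h) -card_ffun cardE; apply: perm_size.
  apply: uniq_perm; rewrite ?enum_uniq ?fset_uniq // => c.
  by rewrite mem_enum; apply/esym/fset_setP => //; exact: finite_finset.
have uu' v (c : nat -> A) : v = \sum_(i < k) c i *: u i -> forall a, 
    a *: w + v = \sum_(i < k.+1) (if (i : nat) == k then a else c i) *: u' i.
  move=> -> a; rewrite big_ord_recr /= /u' eqxx addrC; congr (_ + _).
  by apply: eq_bigr => i _; rewrite (ltn_eqF (ltn_ord i)).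
apply: (@card_inj2 _ _ _ _ _ _ (fun c y => rep c *: w + y)).
- exact: finite_finset.
- exact: Ufin.
- exact: Ufin.
- move=> c _ _ [v [c' vE] [x Xx ->]].
  exists (rep c *: w + v); last by exists x => //; rewrite addrA.
  by exists (fun i => if i == k then rep c else c' i); apply: uu'.
move=> c y c' y' _ Uy _ Uy' eqcy.
suff cc' : c = c' by split=> //; move: eqcy; rewrite cc' => /addrI.
rewrite -[c]repK -[c']repK; apply/fP; apply: contrapT => /local_part_inv/(_ Xw)[z zw].
apply: Uw; rewrite -zw scalerBl -[rep c *: w](addrK y) eqcy.
have -> : z *: (rep c' *: w + y' - y - rep c' *: w) = z *: ((-1) *: y + y') + 0.
  by rewrite addr0 scaleN1r; congr (_ *: _); rewrite addrAC [rep c' *: w + _]addrC addrK addrC.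
apply: (UL); first exact: UL.
exists 0; first exact: span0.
by exists 0; [exact: local_part0|rewrite scaler0 addr0].
Qed.

(** Nakayama by counting: if [d] elements never suffice modulo [pi X], then [d.+1] steps give
    [(q ^ h) ^ d.+1] classes modulo [pi X], against [small_torsion]. Iterating then removes [pi X],
    as [pi] is nilpotent on [X]. *)
Lemma local_generation :
  exists2 u, forall i, X (u i) & X `<=` span d u.
Proof.
have [u Xu XU] : exists2 u, forall i, X (u i) & X `<=` U d u.
  apply: contrapT => no.
  have none k u : (k <= d)%N -> (forall i, X (u i)) -> ~ X `<=` U k u.
    move=> kd Xu XU; apply: no; exists u => // w /XU[v [c ->] [x Xx ->]].
    exists (\sum_(i < k) c i *: u i); last by exists x.
    exists (fun i => if (i < k)%N then c i else 0).
    rewrite (big_ord_widen d (fun i => c i *: u i)) // big_mkcond.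
    by apply: eq_bigr => i _; case: ifP => // _; rewrite scale0r.
  have big k : (k <= d.+1)%N -> exists2 u, forall i, X (u i) &
      ((q ^ h) ^ k * card piX <= card (U k u))%N.
    elim: k => [|k IH] kd.
      exists (fun=> 0) => [i|]; first exact: local_part0.
      rewrite mul1n; apply: card_setS => [|_ [x Xx <-]]; first apply: Ufin => i. exact local_part0.
      by exists 0; [exact: span0|exists x => //; rewrite add0r].
    have [u Xu le] := IH (ltnW kd).
    have [u' Xu' le'] := local_generation_step Xu (none k u kd Xu).
    exists u' => //; apply: leq_trans le'.
    by rewrite expnS -mulnA leq_mul2l le orbT.
  have [u Xu le] := big d.+1 (leqnn _).
  have : (card (U d.+1 u) <= card X)%N.
    apply: card_setS => // _ [v sv [x Xx ->]]; rewrite addrC; apply: local_partL => //.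
    by apply: (span_sub local_part0 local_partL) sv.
  move=> /(leq_trans le) /leq_trans/(_ card_local_part_le).
  have piX_gt0 : (0 < card piX)%N.
    rewrite cardfs_gt0; apply/fset0Pn; exists 0; apply/(fset_setP _ piXfin).
    by exists 0; [exact: local_part0|rewrite scaler0].
  by rewrite (leq_pmul2r piX_gt0) leqNgt small_torsion.
exists u => // w Xw.
have [m mX] : exists m, forall x, X x -> pi ^+ m *: x = 0.
  have [i [j [ij [z iz]]]] := power_period dnP pi.
  exists i => x Xx.
  have np : ~ p (1 - pi ^+ (j - i)).
    move=> p1; apply: (max1 pP); rewrite -[1](subrK (pi ^+ (j - i))).
    apply: (maxD pP pn) => //; have -> : (j - i = (j - i).-1.+1)%N by lia.
    by rewrite exprSr; apply: (maxM pP).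
  have [y <-] := local_part_inv np (XZ (pi ^+ i) Xx).
  rewrite (scalerA _ (pi ^+ i)) mulrBl mul1r -exprD subnK ?(ltnW ij) // iz.
  by rewrite mulrC -scalerA Wn ?scaler0 //; case: Xx.
suff : forall k, exists2 v, span d u v & exists2 x, X x & w = v + pi ^+ k *: x.
  by move=> /(_ m)[v sv [x Xx ->]]; rewrite mX ?addr0.
elim=> [|k [v sv [x /XU[v' sv' [x' Xx' ->]] ->]]].
  by exists 0; [exact: span0|exists w => //; rewrite add0r expr0 scale1r].
exists (pi ^+ k *: v' + v); first exact: spanL.
by exists x' => //; rewrite scalerDr scalerA -exprSr addrA [_ + v]addrC.
Qed.

End Local.

(* As [h] is the [K]-dimension of [A / p], this implies
   [#|torsion p| <= #|A / p| ^ (dlt / dn)]. *)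
Variable dlt : nat.
Hypothesis torsion_bound : forall p h (f : A -> {ffun 'I_h -> K}),
  maximal_ideal p -> p n -> (forall x y, f x = f y <-> p (x - y)) ->
  forall j, (q ^ j < card (torsion p))%N -> (j.+1 * dn <= dlt * h)%N.

Lemma local_generators p : maximal_ideal p -> p n ->
  exists e, [/\ ~ p e, exists z, e * e - e = n * z
    & exists2 u, forall i, W (u i) /\ e *: u i = u i
      & forall w, W w -> span (dlt %/ dn) u (e *: w)].
Proof.
move=> pP pn; have [e [pe ee einv]] := local_idempotent dnP pP pn.
have [pi ppi piP] := uniformizer dnP pP pn.
have [h [f [rep [fP repK]]]] := maximal_residues dnP pP pn.
exists e; split=> //.
have h_gt0 : (0 < h)%N.
  rewrite lt0n; apply/eqP => h0; apply: (max1 pP); rewrite -[1]subr0; apply/fP.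
  by apply/ffunP => i; have := ltn_ord i; rewrite {2}h0.
have dn_gt0 : (0 < dn)%N.
  rewrite lt0n; apply/eqP => d0; apply: (max1 pP).
  have [g [_ [gP _]]] := degA_residues dnP.
  have /gP[z] : g 1 = g 0 by apply/ffunP => i; have := ltn_ord i; rewrite {2}d0.
  by rewrite subr0 mulrC => ->; apply: (maxM pP).
(* Larger torsion would give [(dlt %/ dn).+1 * dn <= dlt], by [torsion_bound] at the predecessor of
   [h * (dlt %/ dn).+1]. *)
have small : (card (torsion p) < (q ^ h) ^ (dlt %/ dn).+1)%N.
  rewrite -expnM ltnNge; apply/negP => le.
  have pos : (0 < h * (dlt %/ dn).+1)%N by rewrite muln_gt0 h_gt0.
  have /(torsion_bound pP pn fP) : (q ^ (h * (dlt %/ dn).+1).-1 < card (torsion p))%N.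
    by apply: leq_trans le; rewrite ltn_exp2l ?finNzRing_gt1 // prednK.
  rewrite prednK // mulnC mulnCA [(dlt * _)%N]mulnC leq_pmul2l // mulnC.
  by rewrite leqNgt ltn_ceil.
have [u uX Xu] := local_generation pP pn einv ppi piP fP repK small.
exists u => // w Ww; apply: Xu; exact: local_partW.
Qed.

(* If a tuple [w] with a span of maximal size does not span [W], let [p] be a
   maximal ideal in the support of the quotient, with local idempotent [e]:
   replacing [e w] by generators of [e W] enlarges the span. *)
Lemma module_generators : exists2 w, forall i, W (w i) & W `<=` span (dlt %/ dn) w.
Proof.
set d := (dlt %/ dn)%N.
have spanW w : (forall i, W (w i)) -> span d w `<=` W.
  by move=> Ww; apply: span_sub.
have ex0 : exists k, `[< exists2 w, forall i, W (w i) & card (span d w) = k >].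
  by exists (card (span d (fun=> 0))); apply/asboolP; exists (fun=> 0).
have bnd k : `[< exists2 w, forall i, W (w i) & card (span d w) = k >] -> (k <= card W)%N.
  by move=> /asboolP[w Ww <-]; apply: card_setS => //; apply: spanW.
have [k /asboolP[w Ww wk] kmax] := ex_maxnP ex0 bnd.
exists w => //; apply: contrapT => Wspan.
have [f [rep [fP repK]]] := degA_residues dnP.
have SL := @spanL d w; have S0 := span0 d w.
have SZ a v : span d w v -> span d w (a *: v).
  by move=> sv; rewrite -[a *: v]addr0; apply: SL.
have WZ a v : W v -> W (a *: v) by move=> Wv; rewrite -[a *: v]addr0; apply: WL.
(* The annihilator of [x] modulo the span, seen in [A / n]. A largest one among non-zero classes is
   prime, and it is maximal because [A / n] is finite. *)
pose ann x := [set z | `[< span d w (rep z *: x) >]]%SET.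
have annP x a : W x -> (f a \in ann x) = `[< span d w (a *: x) >].
  move=> Wx; rewrite finset.inE; apply: asbool_equiv_eq.
  have [z az] : exists z, rep (f a) - a = n * z by apply/fP; rewrite repK.
  suff -> : rep (f a) *: x = a *: x by [].
  by apply/eqP; rewrite -subr_eq0 -scalerBl az mulrC -scalerA Wn ?scaler0.
have ex1 : exists k, `[< exists x, [/\ W x, ~ span d w x & #|ann x| = k] >].
  have [x [Wx Sx]] : exists x, W x /\ ~ span d w x.
    by apply: contrapT => no; apply: Wspan => x Wx; apply: contrapT => Sx; apply: no; exists x.
  by exists #|ann x|; apply/asboolP; exists x.
have bnd1 k' : `[< exists x, [/\ W x, ~ span d w x & #|ann x| = k'] >] ->
    (k' <= #|{ffun 'I_dn -> K}|)%N.
  by move=> /asboolP[x [_ _ <-]]; apply: max_card.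
have [k1 /asboolP[x [Wx Sx xk]] k1max] := ex_maxnP ex1 bnd1.
pose p : set A := [set a | span d w (a *: x)].
have p_mul a b : ~ p a -> p (a * b) -> p b.
  move=> pa pab; have sub : ann x \subset ann (a *: x).
    apply/fintype.subsetP => z; rewrite !finset.inE => /asboolP Sz; apply/asboolP.
    by rewrite scalerA mulrC -scalerA; apply: SZ.
  have eqa : ann x = ann (a *: x).
    apply/eqP; rewrite eqEcard sub xk k1max //; apply/asboolP.
    by exists (a *: x); split=> //; apply: WZ.
  apply/asboolP; rewrite -annP // eqa annP ?scalerA; last exact: WZ.
  by apply/asboolP; rewrite mulrC.
have pP : maximal_ideal p.
  split.
  - by move=> a b pa pb; rewrite /p /= scalerBl addrC -scaleN1r; apply: SL.
  - by move=> a b pb; rewrite /p /= -scalerA; apply: SZ.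
  - by rewrite /p /= scale1r.
  move=> a pa; have [i [j [ij [z iz]]]] := power_period dnP a.
  exists (a ^+ (j - i).-1); rewrite -exprS prednK ?subn_gt0 //.
  have pai : p (a ^+ i * (1 - a ^+ (j - i))).
    rewrite mulrBr mulr1 -exprD subnKC ?(ltnW ij) // iz /p /=.
    by rewrite mulrC -scalerA Wn // scaler0.
  move: pai; move: (1 - _) => y; elim: i {ij iz} => [|i IH]; first by rewrite expr0 mul1r.
  by rewrite exprS -mulrA => /(p_mul _ _ pa).
have pn : p n by rewrite /p /= Wn.
have [e [pe [z ez] [u uX Xu]]] := local_generators pP pn.
(* Keep [w] away from [p] and use generators of [e W] at [p]; the parts do not interfere, as
   [e * (1 - e)] kills [W]. *)
pose v i := (1 - e) *: w i + u i.
have Wv i : W (v i) by apply: WL => //; case: (uX i).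
have e0 y : W y -> (e * (1 - e)) *: y = 0.
  move=> Wy; have -> : e * (1 - e) = n * - z by rewrite mulrN -ez; ring.
  by rewrite mulrC -scalerA Wn ?scaler0.
have ev i : e *: v i = u i.
  by rewrite scalerDr scalerA e0 // add0r; case: (uX i).
have e'v i : (1 - e) *: v i = (1 - e) *: w i.
  rewrite scalerDr [X in _ + X](_ : _ = 0) ?addr0.
    apply/eqP; rewrite scalerA -subr_eq0 -scalerBl.
    have -> : (1 - e) * (1 - e) - (1 - e) = - (e * (1 - e)) by ring.
    by rewrite scaleNr e0 // oppr0.
  by have [_ <-] := uX i; rewrite scalerA mulrC e0 //; case: (uX i).
have span_e y : W y -> span d v (e *: y).
  move=> /Xu[c ->]; exists (fun i => c i * e); apply: eq_bigr => i _.
  by rewrite -scalerA ev.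
have span_w : span d w `<=` span d v.
  move=> y Sy; have Wy := spanW _ Ww _ Sy.
  have -> : y = 1 *: (e *: y) + (1 - e) *: y.
    by rewrite scale1r -scalerDl addrC subrK scale1r.
  apply: spanL; first exact: span_e.
  case: Sy => c ->; exists (fun i => c i * (1 - e)).
  rewrite scaler_sumr; apply: eq_bigr => i _.
  by rewrite -scalerA e'v !scalerA mulrC.
have lt : (card (span d w) < card (span d v))%N.
  apply: (card_set_proper (x := e *: x)) => //; last exact: span_e.
  by apply: sub_finite_set Wfin; apply: spanW.
have : (card (span d v) <= k)%N by apply: kmax; apply/asboolP; exists v.
by rewrite leqNgt -wk lt.
Qed.

(** The map from [(A / n) ^ s] onto [W] with [s = dlt %/ dn] gives [dlt <= s * dn], hence equality,
    and a surjection between finite sets of equal size is injective. *)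
Lemma module_free : card W = (q ^ dlt)%N -> exists s, (s * dn = dlt)%N /\
  exists e : 'I_s -> M, [/\ forall i, W (e i),
    forall w, W w -> exists c : 'I_s -> A, w = \sum_(i < s) c i *: e i
  & forall c : 'I_s -> A, \sum_(i < s) c i *: e i = 0 <->
      forall i, exists z, c i = n * z].
Proof.
move=> cardW; have [w Ww Wspan] := module_generators.
set s := (dlt %/ dn)%N in Wspan.
have [f [rep [fP repK]]] := degA_residues dnP.
pose comb (c : {ffun 'I_s -> {ffun 'I_dn -> K}}) := \sum_(i < s) rep (c i) *: w i.
have repf (c : 'I_s -> A) : comb [ffun i => f (c i)] = \sum_(i < s) c i *: w i.
  apply: eq_bigr => i _; rewrite ffunE; apply/eqP; rewrite -subr_eq0 -scalerBl.
  have [z ->] : exists z, rep (f (c i)) - c i = n * z by apply/fP; rewrite repK.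
  by rewrite mulrC -scalerA Wn // scaler0.
have surj x : W x -> exists c, x = comb c.
  by move=> /Wspan[c ->]; exists [ffun i : 'I_s => f (c i)]; rewrite repf.
have cardY : #|{ffun 'I_s -> {ffun 'I_dn -> K}}| = (q ^ (s * dn))%N.
  by rewrite !card_ffun !card_ord -expnM mulnC.
have sdn : (s * dn = dlt)%N.
  apply/eqP; rewrite eqn_leq leq_divM -(leq_exp2l _ _ (finNzRing_gt1 K)) -cardW -cardY.
  have /choice[g gP] : forall x, exists c, W x -> x = comb c.
    move=> x; have [/surj[c xc]|no] := pselect (W x); first by exists c.
    by exists [ffun=> [ffun=> 0]].
  by apply: (card_fin_inj (f := g)) => // x y /gP {2}-> /gP {2}-> ->.
have inj : injective comb.
  by apply: card_surj_inj Wfin surj _; rewrite cardW cardY sdn.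
exists s; split=> //; exists (fun i => w i); split=> // [x /Wspan[c ->]|c].
  by exists (fun i => c i).
split=> [|nc]; last first.
  rewrite big1 // => i _; have [z ->] := nc i.
  by rewrite mulrC -scalerA Wn // scaler0.
have comb0 : comb [ffun=> f 0] = 0.
  transitivity (\sum_(i < s) (0 : A) *: w i); last by rewrite big1 // => i _; rewrite scale0r.
  by rewrite -repf; congr comb; apply/ffunP => i; rewrite !ffunE.
rewrite -repf => c0 i; have /inj/ffunP eqf := etrans c0 (esym comb0).
by have := eqf i; rewrite !ffunE => /fP[z]; rewrite subr0; exists z.
Qed.

End FiniteModules.

(** * Reciprocal maps *)

Section NTorsion.
Local Notation card S := #|` fset_set S|.
Variables (K : finFieldType) (F : fieldType) (Oinf : set F).
Notation A := (coef_ring Oinf).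
Variables (iota : {rmorphism K -> A}) (r : nat) (N : {pred A}) (n : A).
Notation M := {ffun 'I_r -> FmodA Oinf}.
Hypotheses (n0 : n != 0) (nN : n \in N) (Nn : forall x, x \in N -> exists b, x = n * b).
Notation q := #|K|.
Implicit Types (a b : A) (v w : M).

Lemma Div_dvd a : Div N a <-> exists b, n = a * b.
Proof.
split=> [/(_ n nN)//|[b nab] m /Nn[c ->]].
by exists (b * c); rewrite nab mulrA.
Qed.

Lemma Div_neq0 a : Div N a -> a != 0.
Proof. by move=> /Div_dvd[b nab]; apply: contraNneq n0 => a0; rewrite nab a0 mul0r. Qed.

Lemma val_coef_neq0 a : a != 0 -> val a != 0.
Proof. by rewrite -(inj_eq val_inj) rmorph0. Qed.

Lemma val_mulK a b : a != 0 -> val (a * b) / val a = val b.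
Proof.
move=> /val_coef_neq0 a0; have -> : val (a * b) = val a * val b by exact: rmorphM.
by rewrite mulrAC divff ?mul1r.
Qed.

Lemma classA_eq0 (x : F) : (classA Oinf x == 0) = (x \in regular_outside Oinf).
Proof.
have -> : 0 = classA Oinf 0 by apply: (addrI (classA Oinf 0)); rewrite -classAD !addr0.
by rewrite classA_eq subr0.
Qed.

Lemma VN_torsion v : VN N v <-> n *: v = 0.
Proof.
split=> [vN|nv].
  apply/ffunP => i; rewrite !ffunE; have [x xN ->] := vN i.
  apply/eqP; rewrite [_ *: _]scaleA_class classA_eq0 mulrC.
  exact: xN.
move=> i; have [x vx] := classA_surj (v i); exists x => // m /Nn[b ->].
have /ffunP/(_ i) := nv; rewrite !ffunE vx => /eqP.
rewrite [_ *: _]scaleA_class classA_eq0 => nx.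
rewrite rmorphM mulrA [x * _]mulrC rpredM //; exact: valP.
Qed.

Lemma Va_torsion a v : a != 0 -> Va a v <-> a *: v = 0.
Proof.
move=> /val_coef_neq0 a0; split=> [va|av].
  apply/ffunP => i; rewrite !ffunE; have [b ->] := va i.
  by apply/eqP; rewrite [_ *: _]scaleA_class classA_eq0 mulrA divff // mul1r; apply: valP.
move=> i; have [x vx] := classA_surj (v i).
have /ffunP/(_ i) := av; rewrite !ffunE vx => /eqP.
rewrite [_ *: _]scaleA_class classA_eq0 => ax.
by exists (CoefRing ax); rewrite /= mulKf.
Qed.

Lemma card_VN_le dn : degA_is iota n dn ->
  finite_set (@VN _ _ r N) /\ (card (@VN _ _ r N) <= q ^ (r * dn))%N.
Proof.
move=> dnP; have [f [rep [fP repK]]] := degA_residues dnP.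
pose g (c : {ffun 'I_r -> {ffun 'I_dn -> K}}) : M :=
  [ffun i => classA Oinf (val (rep (c i)) / val n)].
have cover v : VN N v -> exists c, v = g c.
  move=> /VN_torsion nv.
  have /choice[b bP] : forall i, exists b : A, v i = classA Oinf (val b / val n).
    move=> i; have [x vx] := classA_surj (v i).
    have /ffunP/(_ i) := nv; rewrite !ffunE vx => /eqP.
    rewrite [_ *: _]scaleA_class classA_eq0 => nx.
    exists (CoefRing nx); congr classA.
    by rewrite -[RHS]/(val n * x / val n) [val n * x]mulrC mulfK // val_coef_neq0.
  exists [ffun i => f (b i)]; apply/ffunP => i; rewrite !ffunE bP; apply/eqP.
  rewrite classA_eq -mulrBl -rmorphB.
  have [z ->] : exists z, b i - rep (f (b i)) = n * z by apply/fP; rewrite repK.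
  rewrite val_mulK //; exact: valP.
have fin : finite_set (@VN _ _ r N).
  apply: (@sub_finite_set _ _ [set g c | c in setT]) => [v /cover[c ->]|].
    by exists c.
  by apply: finite_image; exact: finite_finset.
split=> //; have /choice[c' cP] : forall v, exists c, VN N v -> v = g c.
  move=> v; have [/cover[c ->]|no] := pselect (VN N v); first by exists c.
  by exists [ffun=> [ffun=> 0]].
rewrite mulnC expnM; apply: leq_trans (card_fin_inj (f := c') fin _) _.
  by move=> v w vN wN cc; rewrite (cP v vN) (cP w wN) cc.
by rewrite !card_ffun !card_ord.
Qed.

End NTorsion.

(** * The module [W] and the factorization of [phi] over it *)

Section Reciprocal.
Local Notation card S := #|` fset_set S|.
Variables (K : finFieldType) (F : fieldType) (Oinf : set F).
Notation A := (coef_ring Oinf).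
Variables (iota : {rmorphism K -> A}) (r : nat) (N : {pred A}) (n : A).
Notation M := {ffun 'I_r -> FmodA Oinf}.
Hypotheses (n0 : n != 0) (nN : n \in N) (Nn : forall x, x \in N -> exists b, x = n * b).
Notation q := #|K|.
Implicit Types (a b : A) (v w : M).
Variables (R : comUnitAlgType F) (rho : M -> R).
Hypotheses (VNfin : finite_set (@VN _ _ r N)) (hrho : reciprocal N rho)
  (hunit : forall v, VN N v -> v != 0 -> rho v = 0 \/ rho v \is a GRing.unit).
Notation W := (unit_locus N rho).
Notation lam := (inv_map rho).

Let DivP a : Div N a <-> exists b, n = a * b. Proof. exact: (Div_dvd nN Nn). Qed.
Let Div_neq0 a : Div N a -> a != 0. Proof. exact: (Div_neq0 n0 nN Nn). Qed.
Let VNP v : VN N v <-> n *: v = 0. Proof. exact: (VN_torsion nN Nn). Qed.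
Let VaP a v : a != 0 -> Va a v <-> a *: v = 0. Proof. exact: Va_torsion. Qed.

Lemma VNL a v w : VN N v -> VN N w -> VN N (a *: v + w).
Proof.
move=> /VNP nv /VNP nw; apply/VNP.
by rewrite scalerDr nw scalerA mulrC -scalerA nv scaler0 addr0.
Qed.

Lemma VN0 : VN N (0 : M). Proof. by apply/VNP; rewrite scaler0. Qed.

Lemma VND v w : VN N v -> VN N w -> VN N (v + w).
Proof. by move=> vN wN; rewrite -[v]scale1r; apply: VNL. Qed.

Lemma VNZ a v : VN N v -> VN N (a *: v).
Proof. by move=> vN; rewrite -[a *: v]addr0; apply: VNL => //; apply: VN0. Qed.

Lemma VNN v : VN N v -> VN N (- v).
Proof. by rewrite -scaleN1r; apply: VNZ. Qed.

Lemma unit_locus_VN v : W v -> VN N v.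
Proof. by case=> [->|[]//]; apply: VN0. Qed.

Lemma unit_locus_fin : finite_set W.
Proof. by apply: sub_finite_set VNfin => v; apply: unit_locus_VN. Qed.

Lemma unit_locus0 : W 0. Proof. by left. Qed.

Lemma inv_map0 : lam 0 = 0. Proof. by rewrite /inv_map eqxx. Qed.

Lemma unit_locus_neq0 v : W v -> v != 0 ->
  [/\ rho v \is a GRing.unit, lam v \is a GRing.unit & rho v = (lam v)^-1].
Proof. by case=> [->|[_ _ uv]]; rewrite /inv_map ?eqxx // => /negbTE ->; rewrite unitrV invrK. Qed.

Lemma rho_outside v : VN N v -> ~ W v -> rho v = 0.
Proof.
move=> vN Wv; have v0 : v != 0 by apply/eqP => v0; apply: Wv; left.
by have [//|uv] := hunit vN v0; case: Wv; right.
Qed.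

(** The first relation excludes [v + (- v) = 0]; the second one at [a = -1] helps, because [Va (-1)]
    is zero. *)
Lemma rhoN v : VN N v -> v != 0 -> rho (- v) = - rho v.
Proof.
move=> vN v0; have N1 : (-1 : A) != 0 by rewrite oppr_eq0 oner_eq0.
have VaN1 w : Va (-1) w <-> w = 0.
  by rewrite VaP // scaleN1r; split=> [/eqP|->]; rewrite ?oppr0 // oppr_eq0 => /eqP.
have DN1 : Div N (-1 : A) by apply/DivP; exists (- n); rewrite mulrNN mul1r.
have := hrho.2 _ v DN1 vN; rewrite VaN1 => /(_ (elimN eqP v0)).
have -> : Va (-1) = [set 0] :> set M by apply/seteqP; split=> w /VaN1.
rewrite fsbig_set1 subr0 !scaleN1r mulN1r => <-.
by rewrite opprK.
Qed.

Lemma unit_locusN v : W v -> W (- v) /\ lam (- v) = - lam v.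
Proof.
move=> Wv; have [->|v0] := eqVneq v 0; first by rewrite oppr0 inv_map0 oppr0; split=> //; left.
have [uv _ _] := unit_locus_neq0 Wv v0; have vN := unit_locus_VN Wv.
rewrite /inv_map oppr_eq0 (negbTE v0) rhoN // invrN; split=> //; right.
by rewrite oppr_eq0 rhoN // unitrN; split=> //; apply: VNN.
Qed.

(** Invertibility of [rho v * rho w] passes to its factor [rho (v + w)]; dividing the first relation
    by all three values gives additivity. *)
Lemma unit_locusD v w : W v -> W w -> W (v + w) /\ lam (v + w) = lam v + lam w.
Proof.
move=> Wv Ww; have [->|v0] := eqVneq v 0; first by rewrite inv_map0 !add0r.
have [->|w0] := eqVneq w 0; first by rewrite inv_map0 !addr0.
have [vw0|vw0] := eqVneq (v + w) 0.
  have -> : w = - v by apply/eqP; rewrite -addr_eq0 addrC vw0.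
  have [_ ->] := unit_locusN Wv; rewrite !subrr inv_map0.
  by split=> //; apply: unit_locus0.
have [uv _ _] := unit_locus_neq0 Wv v0; have [uw _ _] := unit_locus_neq0 Ww w0.
have vN := unit_locus_VN Wv; have wN := unit_locus_VN Ww.
have rel := hrho.1 _ _ vN wN v0 w0 vw0.
have uvw : rho (v + w) \is a GRing.unit.
  by have : rho v * rho w \is a GRing.unit by [rewrite unitrM uv]; rewrite rel unitrM => /andP[].
split; first by right; split=> //; apply: VND.
rewrite /inv_map (negbTE vw0) (negbTE v0) (negbTE w0).
have uvw2 : rho v * rho w \is a GRing.unit by rewrite unitrM uv.
apply: (mulIr uvw2); rewrite {1}rel (mulKr uvw) mulrDl (mulKr uv) mulrCA (mulVr uw).
by rewrite mulr1 addrC.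
Qed.

(** By additivity the difference is [lam (v - w)]. Hence the values of [lam] can be counted as roots
    over [R] and stay distinct in every fiber. *)
Lemma inv_mapB_unit v w : W v -> W w -> v != w -> lam v - lam w \is a GRing.unit.
Proof.
move=> Wv Ww vw; have [WNw <-] := unit_locusN Ww; have [Wvw <-] := unit_locusD Wv WNw.
by have [] := unit_locus_neq0 Wvw; rewrite ?subr_eq0.
Qed.

Lemma algebra_unit a : a != 0 -> (val a)%:A \is a @GRing.unit R.
Proof. by move=> /val_coef_neq0 a0; rewrite (rmorph_unit (in_alg R)) // unitfE. Qed.

Variable phi : A -> {poly R}.
Hypothesis hphi : associated iota N rho phi.

Let Va_fin a : Div N a -> finite_set (@Va _ _ r a).
Proof.
move=> Da; apply: sub_finite_set VNfin => v /(VaP _ (Div_neq0 Da)) av; apply/VNP.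
by have /DivP[b ->] := Da; rewrite mulrC -scalerA av scaler0.
Qed.

Let WVa_fin a : finite_set (W `&` @Va _ _ r a).
Proof. by apply: sub_finite_set unit_locus_fin => v []. Qed.

(** Factors with [rho v = 0] are [1], the others are [- rho v] times ['X - lam v], and the factor
    ['X] belongs to [lam 0 = 0]. *)
Lemma associated_factor a : Div N a -> exists2 k, k \is a GRing.unit &
  phi a = k *: \prod_(u <- fset_set (W `&` @Va _ _ r a)) ('X - (lam u)%:P).
Proof.
move=> Da; have a0 := Div_neq0 Da; rewrite (hphi.2 a Da).
have V0 : Va a (0 : M) by apply/(VaP _ a0); rewrite scaler0.
pose U := W `&` @Va _ _ r a; pose U0 := U `\ (0 : M).
have U0fin : finite_set U0 by apply: sub_finite_set (WVa_fin a) => v [].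
rewrite -(fsbig_widen U0) /=; last 2 first.
- by move=> v [[]].
- move=> v [[av v0] U0v]; rewrite /= rho_outside ?scale0r ?subr0 //.
    apply/VNP; have /DivP[b ->] := Da.
    by rewrite mulrC -scalerA (iffLR (VaP _ a0) av) scaler0.
  by move=> Wv; apply: U0v.
exists ((val a)%:A * \prod_(u <- fset_set U0) - rho u).
  rewrite unitrM algebra_unit //= big_seq; elim/big_ind: _ => [||u]; first exact: unitr1.
    by move=> x y ux uy; rewrite unitrM ux.
  move=> /(fset_setP _ U0fin)[[Wu _] /eqP u0]; rewrite unitrN.
  by case: (unit_locus_neq0 Wu u0).
have prodU : \prod_(u <- fset_set U) ('X - (lam u)%:P) =
    'X * \prod_(u <- fset_set U0) ('X - (lam u)%:P).
  have U_0 : U 0 by split; [exact: unit_locus0|].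
  rewrite -!fsbig_finite //; last exact: WVa_fin.
  by rewrite (fsbigD1 (0 : M) U) ?inv_map0 ?subr0 //; apply: WVa_fin.
rewrite prodU -scalerA; congr (_ *: _); rewrite scalerAr; congr (_ * _).
rewrite fsbig_finite // -scaler_prod.
apply: eq_big_seq => u /(fset_setP _ U0fin)[[Wu _] /eqP u0].
have [uu ul ->] := unit_locus_neq0 Wu u0.
by rewrite scalerBr !scaleNr opprK -[_ *: (lam u)%:P]mul_polyC -polyCM mulVr // addrC.
Qed.

Variable D : set A.
Hypotheses (D_Div : D `<=` Div N) (level_approx : forall a, a != 0 ->
  exists b, [/\ b != 0, product_of D b & degA_lt iota (a - b) a]).

Let phiP : tau_hom iota phi. Proof. exact: hphi.1. Qed.
Let phi_tau a : tau_poly K (phi a). Proof. by case: phiP. Qed.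
Let phiD a b : phi (a + b) = phi a + phi b. Proof. by case: phiP. Qed.
Let phiM a b : phi (a * b) = phi a \Po phi b. Proof. by case: phiP. Qed.
Let emb : {rmorphism K -> R} := in_alg R \o (val \o iota).
Let alg : {rmorphism A -> R} := in_alg R \o val.
Let algM a b : (val (a * b))%:A = (val a)%:A * (val b)%:A :> R := rmorphM alg a b.
Let algD a b : (val (a + b))%:A = (val a)%:A + (val b)%:A :> R := rmorphD alg a b.
Let alg0 : (val (0 : A))%:A = 0 :> R := rmorph0 alg.
Let alg1 : (val (1 : A))%:A = 1 :> R := rmorph1 alg.

Lemma associated_lin a : (phi a)`_1 = (val a)%:A.
Proof.
move: a; apply: (level_ring_ind level_approx) => [||a /D_Div Da|a b pa pb|a b pa pb].
- by rewrite (tau_hom0 phiP) coef0 alg0.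
- by rewrite (tau_hom1 phiP) coefX alg1.
- rewrite (hphi.2 a Da) coefZ coefXM /= -horner_coef0.
  rewrite (_ : _.[0] = 1) ?mulr1 // fsbig_finite; last first.
    by apply: sub_finite_set (Va_fin Da) => v [].
  rewrite horner_prod big1 // => v _.
  by rewrite hornerD hornerN hornerZ hornerX mulr0 subr0 -polyC1 hornerC.
- by rewrite phiD coefD pa pb algD.
rewrite -[LHS]mulr1n -[_ *+ 1](coef_deriv _ 0) phiM deriv_comp.
rewrite !(deriv_tau_poly emb) // comp_polyC coefCM coefC /= pa pb.
by rewrite algM.
Qed.

Lemma scaled_unit_locus a v : W v -> W (a *: v) /\ lam (a *: v) = (phi a).[lam v].
Proof.
move: a v; apply: (level_ring_ind level_approx)
  => [v _|v Wv|a Da v Wv|a b pa pb v Wv|a b pa pb v Wv].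
- by rewrite scale0r inv_map0 (tau_hom0 phiP) horner0; split=> //; apply: unit_locus0.
- by rewrite scale1r (tau_hom1 phiP) hornerX.
- move/D_Div: Da => Da; have a0 := Div_neq0 Da; have vN := unit_locus_VN Wv.
  have [k uk phiE] := associated_factor Da.
  have [av|av] := pselect (a *: v = 0).
    rewrite av inv_map0; split; first exact: unit_locus0.
    rewrite phiE hornerZ horner_prod (big_rem v) /=; last first.
      by apply/(fset_setP _ (WVa_fin a)); split=> //; apply/VaP.
    by rewrite hornerXsubC subrr mul0r mulr0.
  have Va_v : ~ Va a v by move/(VaP _ a0).
  have av0 : a *: v != 0 by apply/eqP.
  set s := fset_set (W `&` Va a) in phiE.
  have sP u : u \in s -> [/\ W u, Va a u & v != u].
    move=> /(fset_setP _ (WVa_fin a))[Wu au]; split=> //.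
    by apply: contra_notN Va_v => /eqP ->.
  have s_unit : all (fun t => lam v - t \is a GRing.unit) [seq lam u | u <- s].
    by apply/allP => _ /mapP[u /sP[Wu _ vu] ->]; apply: inv_mapB_unit.
  have phiE' : phi a = k *: \prod_(t <- [seq lam u | u <- s]) ('X - t%:P).
    by rewrite big_map.
  have phi_unit : (phi a).[lam v] \is a GRing.unit.
    rewrite phiE' hornerZ horner_prod unitrM uk big_seq /=.
    elim/big_ind: _ => [|x y ux uy|t ts]; rewrite ?unitr1 ?unitrM ?ux //.
    by rewrite hornerXsubC; move/allP: s_unit; apply.
  (* The derivative of [phi a] is the constant [a], and the inverse of [lam v - lam u] is
     [rho (v - u)]. *)
  have log_deriv : (val a)%:A = (phi a).[lam v] * \sum_(u <- s) rho (v - u).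
    have := congr1 (fun P : {poly R} => P.[lam v]) (deriv_tau_poly emb (@phi_tau a)).
    rewrite /= associated_lin hornerC => <-.
    rewrite phiE' derivZ !hornerZ (horner_deriv_prod_XsubC s_unit) mulrA big_map.
    rewrite horner_prod; congr (_ * _ * _).
      by rewrite big_map; apply: eq_bigr => u _; rewrite hornerXsubC.
    rewrite big_map; apply: eq_big_seq => u /sP[Wu _ vu].
    have [WNu lamN] := unit_locusN Wu; have [Wvu lamvu] := unit_locusD Wv WNu.
    have vu0 : v - u != 0 by rewrite subr_eq0.
    have [_ _ ->] := unit_locus_neq0 Wvu vu0.
    by rewrite lamvu lamN.
  have := hrho.2 a v Da vN Va_v.
  (* Terms with [u] outside [W] vanish, since [v - u] is then outside [W] too. *)
  rewrite -(fsbig_widen (W `&` Va a)) /=; last 2 first.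
  + by move=> u [].
  + move=> u [au WVu]; rewrite /= rho_outside //.
      apply: VND => //; apply/VNN/VNP; have /DivP[b ->] := Da.
      by rewrite mulrC -scalerA (iffLR (VaP _ a0) au) scaler0.
    move=> Wvu; apply: WVu; split=> //.
    have -> : u = v + - (v - u) by rewrite opprB addrC subrK.
    by have [WN _] := unit_locusN Wvu; case: (unit_locusD Wv WN).
  rewrite fsbig_finite // -/s => rel.
  have uA := algebra_unit a0.
  have inv : (phi a).[lam v] * rho (a *: v) = 1.
    by apply: (mulrI uA); rewrite mulrCA rel -log_deriv mulr1.
  have urho : rho (a *: v) \is a GRing.unit.
    by apply/unitrPr; exists (phi a).[lam v]; rewrite mulrC.
  split; first by right; split=> //; apply: VNZ.
  by rewrite /inv_map (negbTE av0); apply: (mulIr urho); rewrite inv mulVr.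
- have [Wa la] := pa _ Wv; have [Wb lb] := pb _ Wv.
  by rewrite scalerDl phiD hornerD -la -lb; apply: unit_locusD.
have [Wb lb] := pb _ Wv; have [Wab lab] := pa _ Wb.
by rewrite -scalerA phiM horner_comp -lb.
Qed.

Lemma unit_locusL a v w : W v -> W w -> W (a *: v + w).
Proof. by move=> Wv Ww; have [Wav _] := scaled_unit_locus a Wv; case: (unit_locusD Wav Ww). Qed.

(** The degree of [phi a] counts the roots in its factorization and, for a tau-polynomial, is a
    power of [q]. *)
Lemma associated_unit_lead a : Div N a -> exists2 m, unit_lead K phi a m &
  card (W `&` Va a) = (q ^ m)%N.
Proof.
move=> Da; have [k uk phiE] := associated_factor Da.
have kX (P : {poly R}) : lead_coef P = 1 -> size (k *: P) = size P /\ lead_coef (k *: P) = k.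
  move=> P1; have kl : GRing.lreg k by apply: mulrI.
  by rewrite lead_coef_lreg // P1 mulr1 lreg_size.
have [sz lc] := kX _ (monicP (monic_prod_XsubC (fset_set (W `&` Va a)) xpredT lam)).
rewrite -phiE size_prod_XsubC in sz; rewrite -phiE in lc.
have phi0 : phi a != 0 by rewrite -size_poly_gt0 sz.
have [m szm] := tau_poly_size (@phi_tau a) phi0.
by exists m; [split=> //; rewrite lc|move: szm; rewrite sz => -[]].
Qed.

Lemma associated_trivial : W = [set 0] -> forall a, phi a = (val a)%:A *: 'X.
Proof.
move=> W0; apply: (level_ring_ind level_approx) => [||a /D_Div Da|a b pa pb|a b pa pb].
- by rewrite (tau_hom0 phiP) alg0 scale0r.
- by rewrite (tau_hom1 phiP) alg1 scale1r.
- have [k _ phiE] := associated_factor Da.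
  have V0 : Va a (0 : M) by apply/(VaP _ (Div_neq0 Da)); rewrite scaler0.
  have phiX : phi a = k *: 'X.
    rewrite phiE W0 (_ : [set 0] `&` Va a = [set 0]).
      by rewrite fset_set1 big_seq_fset1 inv_map0 subr0.
    by apply/seteqP; split=> [v []//|v ->].
  by have := associated_lin a; rewrite phiX coefZ coefX mulr1 => ->.
- by rewrite phiD pa pb algD scalerDl.
by rewrite phiM pa pb comp_polyZ comp_polyX scalerA algM.
Qed.

Lemma unit_locus_torsion v : W v -> n *: v = 0.
Proof. by move=> /unit_locus_VN /VNP. Qed.

Variable dn : nat.
Hypotheses (dnP : degA_is iota n dn) (W_neq0 : W <> [set 0]).

Lemma unit_locus_card : exists dlt,
  [/\ (0 < dlt)%N, unit_lead K phi n dlt & card W = (q ^ dlt)%N].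
Proof.
have Dn : Div N n by apply/DivP; exists 1; rewrite mulr1.
have [m nm] := associated_unit_lead Dn; rewrite (_ : W `&` _ = W); last first.
  by apply/seteqP; split=> [v []//|v Wv]; split=> //; apply/VaP => //; apply: unit_locus_torsion.
move=> cardW; exists m; split=> //; rewrite lt0n; apply/eqP => m0.
have [w [Ww w0]] : exists w, W w /\ w <> 0.
  apply: contrapT => no; apply: W_neq0; apply/seteqP; split=> [w Ww|w ->]; last exact: unit_locus0.
  by apply: contrapT => w0; apply: no; exists w.
have : (card [set (0%R : M)] < card W)%N.
  apply: (card_set_proper (x := w)) => //; first exact: unit_locus_fin.
  by move=> _ ->; exact: unit_locus0.
by rewrite cardW m0 fset_set1 cardfs1 expn0.
Qed.

Variable dlt : nat.
Hypotheses (dlt_gt0 : (0 < dlt)%N) (n_lead : unit_lead K phi n dlt)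
  (cardW : card W = (q ^ dlt)%N).

Lemma associated_unit_lead_all a : a != 0 -> exists m d,
  [/\ unit_lead K phi a m, degA_is iota a d & (m * dn = dlt * d)%N].
Proof.
apply: (unit_lead_all level_approx phiP associated_lin _ n_lead dlt_gt0 dnP).
by move=> b /D_Div /associated_unit_lead[m bm _]; exists m.
Qed.

(** [slope_le] with reference element [n] combines the index bound for symbolic powers with the
    lower bound [torsion_rank_le] at [d = j.+1]. *)
Lemma unit_locus_torsion_bound p h (f : A -> {ffun 'I_h -> K}) :
  maximal_ideal p -> p n -> (forall x y, f x = f y <-> p (x - y)) ->
  forall j, (q ^ j < card (torsion W p))%N -> (j.+1 * dn <= dlt * h)%N.
Proof.
move=> pP pn fP j jlt; have [pi ppi piP] := uniformizer dnP pP pn.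
have tfin : finite_set (torsion W p) by apply: sub_finite_set unit_locus_fin => v [].
apply: (slope_le (J := symbolic_power p pi) phiP dnP
  (unit_lead_tau_deg_le n_lead)
  (fun k => symbolic_power_index_le pP pn piP k fP)) => k a m ka a0 am.
apply: (torsion_rank_le dnP pP pn piP phiP _
  (rs := [seq lam w | w <- fset_set (torsion W p)])) ka a0 am => //.
- by move=> b /associated_unit_lead_all[mb [_ [bm _ _]]]; exists mb.
- apply: uniq_roots_map => [|v w /(fset_setP _ tfin)[Wv _] /(fset_setP _ tfin)[Ww _]].
    exact: fset_uniq.
  exact: inv_mapB_unit.
- move=> l; rewrite ltnS size_map => lj; apply: leq_trans jlt.
  by rewrite ltnS leq_exp2l // finNzRing_gt1.
- move=> _ /mapP[w /(fset_setP _ tfin)[Ww pw] ->].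
  by have [_ <-] := scaled_unit_locus pi Ww; rewrite pw // inv_map0.
move=> x px _ /mapP[w /(fset_setP _ tfin)[Ww pw] ->].
(* [y] inverts [x] modulo [p], hence on [W[p]]. *)
have [y xy] := max_inv pP px; have [Wyw _] := scaled_unit_locus y Ww.
exists (lam (y *: w)).
  apply: map_f; apply/(fset_setP _ tfin); split=> // b pb.
  by rewrite scalerA mulrC -scalerA pw // scaler0.
have [_ <-] := scaled_unit_locus x Wyw; congr (lam _).
by apply/eqP; rewrite scalerA -subr_eq0 -{1}[w]scale1r -scalerBl pw.
Qed.

Hypothesis hN : idealr_closed N.

Lemma unit_locus_free : exists s, [/\ (s * dn = dlt)%N, (1 <= s <= r)%N &
  free_of_rank N W s].
Proof.
have [s [sdn [e [We gen rel]]]] := module_free dnP unit_locus_fin unit_locus0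
  unit_locusL unit_locus_torsion unit_locus_torsion_bound cardW.
have dn_gt0 : (0 < dn)%N by move: dlt_gt0; rewrite -sdn muln_gt0 => /andP[].
exists s; split=> //; last first.
  exists e; split=> // c; rewrite rel; split=> ci i.
    by have [z ->] := ci i; have [N0 _ NL] := hN; rewrite mulrC -[_ * n]addr0 NL.
  by apply: Nn; apply: ci.
apply/andP; split; first by move: dlt_gt0; rewrite -sdn muln_gt0 => /andP[].
rewrite -(leq_pmul2r dn_gt0) -(leq_exp2l _ _ (finNzRing_gt1 K)) sdn -cardW.
have [VNf le] := @card_VN_le K F Oinf iota r N n n0 nN Nn dn dnP.
by apply: leq_trans le; apply: card_setS VNf _ => v; apply: unit_locus_VN.
Qed.

Lemma associated_standard s : (s * dn = dlt)%N -> standard_drinfeld iota s phi.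
Proof.
move=> sdn; split=> // a a0; have [m [d [am ad eqm]]] := associated_unit_lead_all a0.
have dn_gt0 : (0 < dn)%N by move: dlt_gt0; rewrite -sdn muln_gt0 => /andP[].
have {eqm}ms : m = (s * d)%N.
  by apply/eqP; rewrite -(eqn_pmul2r dn_gt0) eqm -sdn mulnAC.
rewrite ms in am; exists d; split=> //.
- by apply: tau_polyE => //; rewrite am.1.
- by have := am.2; rewrite lead_coefE am.1.
exact: associated_lin.
Qed.

(** In each fiber the values of [lam] remain distinct, so Lagrange interpolation gives surjectivity.
    The image of [phi n] is a non-zero constant times the product over these values, so it divides
    every polynomial vanishing at them. *)
Lemma associated_level_structure s (i : {ffun 'I_s -> FmodA Oinf} -> M) :
  module_iso N W i -> level_structure N phi (lam \o i).
Proof.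
move=> [[iW iinj isurj] iL].
have VNs (v : {ffun 'I_s -> FmodA Oinf}) : VN N v <-> n *: v = 0 := VN_torsion nN Nn v.
have VNs0 : VN N (0 : {ffun 'I_s -> FmodA Oinf}) by apply/VNs; rewrite scaler0.
have i0 : i 0 = 0.
  have := iL 1 0 0 VNs0 VNs0; rewrite !scale1r addr0.
  by move=> /eqP; rewrite addrC -subr_eq subrr => /eqP.
have iZ a y : VN N y -> i (a *: y) = a *: i y.
  by move=> yN; have := iL a y 0 yN VNs0; rewrite i0 !addr0.
have lam_inj (L : fieldType) (g : {rmorphism R -> L}) u v : W u -> W v ->
    g (lam u) = g (lam v) -> u = v.
  move=> Wu Wv; apply: contra_eq => uv; rewrite -subr_eq0 -rmorphB -unitfE.
  by apply/rmorph_unit/inv_mapB_unit.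
split.
- move=> v a vN /Nn[b ->] /=; have Wv := iW _ vN.
  have [_ <-] := scaled_unit_locus (n * b) Wv.
  by rewrite mulrC -scalerA unit_locus_torsion // scaler0 inv_map0.
- move=> v w vN wN /=; have := iL 1 v w vN wN; rewrite !scale1r => ->.
  by case: (unit_locusD (iW _ vN) (iW _ wN)).
- move=> a v vN /=; rewrite iZ //.
  by case: (scaled_unit_locus a (iW _ vN)).
move=> L g; split.
  move=> f; have [VNsf _] := @card_VN_le K F Oinf iota s N n n0 nN Nn dn dnP.
  pose t := fset_set (@VN _ _ s N); pose x y := g (lam (i y)).
  pose lag y := \prod_(z <- t | z != y) ((x y - x z)^-1 *: ('X - (x z)%:P)).
  exists (\sum_(y <- t) f y *: lag y) => v vN.
  have vt : v \in t by apply/fset_setP.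
  rewrite horner_sum (bigD1_seq v) ?fset_uniq //= hornerZ big1_seq ?addr0.
    rewrite /lag horner_prod big1_seq ?mulr1 // => w /andP[wv /(fset_setP _ VNsf) wN].
    rewrite hornerZ hornerXsubC mulVf // subr_eq0.
    apply: contraNneq wv => xvw; apply/eqP/iinj; [exact: mem_set|exact: mem_set|].
    by apply: (lam_inj L g); [exact: iW|exact: iW|exact: esym xvw].
  move=> w /andP[wv /(fset_setP _ VNsf) wN].
  rewrite hornerZ /lag horner_prod (big_rem v) //= eq_sym wv.
  by rewrite hornerZ hornerXsubC subrr mulr0 mul0r mulr0.
move=> p; split=> [p0|[l lN ->] v vN]; last first.
  rewrite horner_sum big1_seq // => y /andP[_ yl]; rewrite hornerM.
  have /Nn[b yb] := lN _ yl; have Wv := iW _ vN.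
  rewrite horner_map; have [_ /= <-] := scaled_unit_locus y.2 Wv.
  by rewrite yb [n * b]mulrC -scalerA unit_locus_torsion // scaler0 inv_map0 rmorph0 mulr0.
have Dn : Div N n by apply/DivP; exists 1; rewrite mulr1.
have [k uk phiE] := associated_factor Dn.
set t := fset_set (W `&` Va n) in phiE.
have tP u : u \in t -> W u by move=> /(fset_setP _ (WVa_fin n))[].
have [||p' pE] := @uniq_roots_prod_XsubC L p [seq g (lam u) | u <- t].
- apply/allP => _ /mapP[u /tP/isurj[v vN <-] ->].
  by apply/eqP; apply: p0.
- rewrite uniq_rootsE map_inj_in_uniq ?fset_uniq // => u v /tP Wu /tP Wv.
  exact: lam_inj.
have gk : g k != 0 by rewrite -unitfE rmorph_unit.
exists [:: ((g k)^-1 *: p', n)] => [y|]; first by rewrite inE => /eqP ->.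
rewrite big_seq1 /= phiE map_polyZ -scalerAr -scalerAl scalerA divff // scale1r.
rewrite {1}pE big_map rmorph_prod; congr (_ * _); apply: eq_bigr => u _.
by rewrite /= map_polyXsubC.
Qed.

End Reciprocal.

Theorem proposition2p5p4
    (K : finFieldType) (F : fieldType) (Oinf : set F)
    (iota : {rmorphism K -> coef_ring Oinf})
    (hF : global_function_field (val \o iota))
    (hinf : place Oinf)
    (r : nat) (hr : (1 <= r)%N)
    (N : {pred coef_ring Oinf}) (hN : idealr_closed N)
    (hN0 : exists2 n, n \in N & n != 0)
    (hlevel : level_assumption iota N)
    (R : comUnitAlgType F)
    (rho : {ffun 'I_r -> FmodA Oinf} -> R)
    (hrho : reciprocal N rho)
    (hunit : forall v, VN N v -> v != 0 ->
               rho v = 0 \/ rho v \is a GRing.unit)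
    (phi : coef_ring Oinf -> {poly R})
    (hphi : associated iota N rho phi) :
  let W := unit_locus N rho in
  let lam := inv_map rho in
  [/\ submod_closed (mem W),
      W = [set 0] -> forall a, phi a = (val a)%:A *: 'X
    & W <> [set 0] ->
      exists s : nat,
        [/\ (1 <= s <= r)%N,
            free_of_rank N W s,
            standard_drinfeld iota s phi
          & forall i : {ffun 'I_s -> FmodA Oinf} -> {ffun 'I_r -> FmodA Oinf},
              module_iso N W i -> level_structure N phi (lam \o i)]].
Proof.
move=> W lam; have [D D_Div [level_approx _ _ [n nN Nn]]] := hlevel.
have n0 : n != 0.
  have [m /Nn[b ->]] := hN0; apply: contraNneq => ->.
  by rewrite mul0r.
have [dn dnP] := level_degA level_approx n0.
have [VNfin _] := card_VN_le r n0 nN Nn dnP.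
split.
- split; first by apply/mem_set/unit_locus0.
  move=> a v w /set_mem Wv /set_mem Ww; apply/mem_set.
  exact: (unit_locusL n0 nN Nn VNfin hrho hunit hphi D_Div level_approx).
- exact: (associated_trivial n0 nN Nn VNfin hunit hphi D_Div level_approx).
move=> W_neq0.
have [dlt [dlt_gt0 n_lead cardW]] := unit_locus_card n0 nN Nn VNfin hunit hphi W_neq0.
have [s [sdn sr Wfree]] := unit_locus_free n0 nN Nn VNfin hrho hunit hphi D_Div
  level_approx dnP dlt_gt0 n_lead cardW hN.
exists s; split=> //.
  exact: (associated_standard n0 nN Nn VNfin hunit hphi D_Div level_approx dnP
    dlt_gt0 n_lead).
exact: (associated_level_structure n0 nN Nn VNfin hrho hunit hphi D_Div level_approx dnP).
Qed.
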